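(* Let $s<\frac14$ and, for positive integers $k$, let $$f_k(x)=\frac{1}{\sqrt{2\pi}}\int_{\mathbb{R}}e^{ix\xi}\,2^{-k(s+\frac12)}\chi_{\{2^k\le|\xi|\le2^{k+1}\}}(\xi)\,d\xi .$$ Then $$\lim_{k\to\infty}\frac{\big\|\sup_{t>0}|U(t)f_k|\big\|_{L^4_x}}{\|f_k\|_{H^s(\mathbb{R})}}=\infty .$$ Consequently, if $s<\frac14$, the maximal inequality $$\|U(t)f\|_{L^4_xL^\infty_t}\le C\|f\|_{H^s(\mathbb{R})}$$ does not hold in general for $f\in H^s(\mathbb{R})$; that is, there is no constant $C$ for which it holds for all $f\in H^s(\mathbb{R})$.
   Context: Fix one of the two signs in $\pm$ (the statement is asserted for each choice). The Fourier transform is $\mathscr{F}_xf(\xi)=\frac{1}{\sqrt{2\pi}}\int_{\mathbb{R}}e^{-ix\xi}f(x)\,dx$. $H^s(\mathbb{R})$ is the space of tempered distributions $f$ with $\|f\|_{H^s(\mathbb{R})}=\|\langle\xi\rangle^s\mathscr{F}_xf\|_{L^2_\xi(\mathbb{R})}<\infty$, where $\langle\xi\rangle^s=(1+\xi^2)^{s/2}$. $U(t)$ is the solution operator of the free Ostrovsky equation $u_t+\partial_x^3u\pm\partial_x^{-1}u=0$, $u(x,0)=f(x)$: $$U(t)f(x)=\frac{1}{\sqrt{2\pi}}\int_{\mathbb{R}}e^{ix\xi+it(\xi^3\pm\frac1\xi)}\mathscr{F}_xf(\xi)\,d\xi .$$ $\chi_E$ denotes the characteristic function of the set $E$. The mixed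 norm is $\|F\|_{L^q_xL^p_t}=\big(\int_{\mathbb{R}}\big(\int_{\mathbb{R}}|F(x,t)|^p\,dt\big)^{q/p}dx\big)^{1/q}$, with the essential supremum over $t\in\mathbb{R}$ when $p=\infty$. *)

(* Defs.v *)
From mathcomp Require Import all_boot all_order all_algebra.
From mathcomp Require Import complex.
From mathcomp Require Import all_classical all_reals all_analysis.

Set Implicit Arguments.
Unset Strict Implicit.
Unset Printing Implicit Defensive.

Import Order.TTheory GRing.Theory Num.Theory.
Import numFieldNormedType.Exports.

Local Open Scope classical_set_scope.
Local Open Scope ring_scope.
Local Open Scope complex_scope.

Local Notation Re := complex.Re.
Local Notation Im := complex.Im.
Local Notation normc := Normc.normc.

Section ComplexValued.
Variable R : realType.
Notation C := R[i].
Notation leb := (@lebesgue_measure R).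

Definition cexpi (x : R) : C := cos x +i* sin x.

Definition cmeasurable d (T : measurableType d) (f : T -> C) : Prop :=
  measurable_fun setT (fun x => Re (f x)) /\
  measurable_fun setT (fun x => Im (f x)).

Definition cintegrable (f : R -> C) : Prop :=
  leb.-integrable setT (fun x => (Re (f x))%:E) /\
  leb.-integrable setT (fun x => (Im (f x))%:E).

Definition cintegral (f : R -> C) : C :=
  (\int[leb]_x Re (f x)) +i* (\int[leb]_x Im (f x)).

Definition cderiv (n : nat) (f : R -> C) (x : R) : C :=
  derive1n n (fun y => Re (f y)) x +i* derive1n n (fun y => Im (f y)) x.

Definition csmooth (f : R -> C) : Prop := forall n x,
  derivable (derive1n n (fun y => Re (f y))) x 1 /\
  derivable (derive1n n (fun y => Im (f y))) x 1.

Definition fourier (f : R -> C) (xi : R) : C :=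
  ((Num.sqrt (2 * pi))^-1)%:C * cintegral (fun x => cexpi (- (x * xi)) * f x).

Definition inv_fourier (g : R -> C) (x : R) : C :=
  ((Num.sqrt (2 * pi))^-1)%:C * cintegral (fun xi => cexpi (x * xi) * g xi).

End ComplexValued.

Section TemperedDistributions.
Variable R : realType.
Notation C := R[i].

Definition schwartz_seminorm (m n : nat) (phi : R -> C) : \bar R :=
  ereal_sup [set (`|x| ^+ m * normc (cderiv n phi x))%:E | x in [set: R]].

Definition schwartz (phi : R -> C) : Prop :=
  csmooth phi /\ forall m n, (schwartz_seminorm m n phi < +oo)%E.

(* An element of [distr] is a functional on all of [R -> C] of which only the
   restriction to Schwartz functions is meaningful. *)
Definition distr : Type := (R -> C) -> C.

Definition tempered (T : distr) : Prop :=
  (forall (a : C) phi psi, schwartz phi -> schwartz psi ->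
     T (fun x => a * phi x + psi x) = a * T phi + T psi) /\
  (exists (N : nat) (A : R), forall phi, schwartz phi ->
     ((normc (T phi))%:E <=
      A%:E * \sum_(m < N.+1) \sum_(n < N.+1) schwartz_seminorm m n phi)%E).

Definition distr_of_fun (g : R -> C) : distr :=
  fun phi => cintegral (fun x => g x * phi x).

Definition represents (g : R -> C) (T : distr) : Prop :=
  @cmeasurable R _ (measurableTypeR R) g /\
  forall phi, schwartz phi ->
    cintegrable (fun x => g x * phi x) /\ T phi = distr_of_fun g phi.

Definition is_function (T : distr) : Prop := exists g, represents g T.

Definition distr_fourier (T : distr) : distr :=
  fun phi => T (fourier phi).

Definition distr_inv_fourier (T : distr) : distr :=
  fun phi => T (inv_fourier phi).

(* The Fourier transform of [T] as a function, when it is one; it is then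
   determined almost everywhere. *)
Definition fourier_fun (T : distr) : R -> C :=
  xget (fun=> 0) [set g | represents g (distr_fourier T)].

Definition japanese_bracket (xi : R) : R := Num.sqrt (1 + xi ^+ 2).

Definition sobolev_norm (s : R) (T : distr) : \bar R :=
  (if `[< is_function (distr_fourier T) >] then
    'N[@lebesgue_measure R]_(2%:E)
      [(fun xi => (japanese_bracket xi `^ s * normc (fourier_fun T xi))%:E)]
  else +oo)%E.

Definition sobolev (s : R) (T : distr) : Prop :=
  tempered T /\ (sobolev_norm s T < +oo)%E.

End TemperedDistributions.

Section Ostrovsky.
Variable R : realType.
Notation C := R[i].
Notation leb := (@lebesgue_measure R).

(* [neg = false] is the sign + in [xi^3 +- 1/xi], [neg = true] the sign -. *)
Definition dispersion (neg : bool) (xi : R) : R :=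
  xi ^+ 3 + (-1) ^+ neg * xi^-1.

Definition evolved_fourier (neg : bool) (t : R) (f : distr R) : R -> C :=
  fun xi => cexpi (t * dispersion neg xi) * fourier_fun f xi.

(* [U(t) f (x)] as an absolutely convergent integral, which makes sense when
   the Fourier transform of [f] is integrable. *)
Definition ostrovsky (neg : bool) (t : R) (f : distr R) : R -> C :=
  inv_fourier (evolved_fourier neg t f).

(* [U(t) f] for arbitrary [f] in [H^s]: the integral is the inverse Fourier
   transform of a tempered distribution. *)
Definition ostrovsky_distr (neg : bool) (t : R) (f : distr R) :
    distr R :=
  distr_inv_fourier (distr_of_fun (evolved_fourier neg t f)).

(* [F (x, t)] is the value at [x] of [U(t) f]. *)
Definition ostrovsky_version (neg : bool) (f : distr R)
    (F : R * R -> C) : Prop :=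
  @cmeasurable R _ (measurableTypeR R * measurableTypeR R)%type F /\
  forall t, represents (fun x => F (x, t)) (ostrovsky_distr neg t f).

Definition mixed_norm (q p : \bar R) (F : R * R -> C) : \bar R :=
  ('N[leb]_q [(fun x => 'N[leb]_p [(fun t => (normc (F (x, t)))%:E)])])%E.

Definition maximal_fun (neg : bool) (f : distr R) (x : R) : \bar R :=
  ereal_sup [set (normc (ostrovsky neg t f x))%:E | t in [set t | 0 < t]].

(* The inequality is required only of those [f] in [H^s] for which [U(t) f] is
   given by a measurable function of [(x, t)]; that function is unique almost
   everywhere. *)
Definition ostrovsky_maximal_inequality (neg : bool) (s A : R) : Prop :=
  forall f, sobolev s f -> forall F, ostrovsky_version neg f F ->
    (mixed_norm 4%:E +oo F <= A%:E * sobolev_norm s f)%E.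

Definition dyadic_annulus (k : nat) : set R :=
  [set xi | 2 ^+ k <= `|xi| <= 2 ^+ k.+1].

Definition f_dyadic (s : R) (k : nat) : R -> C :=
  inv_fourier (fun xi =>
    ((2 : R) `^ (- (k%:R * (s + 1 / 2))) * \1_(dyadic_annulus k) xi)%:C).

End Ostrovsky.

(* Main.v *)
(* On the support |xi| ~ 2^k of the Fourier transform of f_k, the phase
   x xi + t (xi^3 +- 1/xi) is at most 1 in absolute value as soon as
   |x| <= 2^-k / 4 and 0 <= t <= 2^-3k / 32. There is then no cancellation:
   |U(t) f_k (x)| >= c 2^(k(1/2 - s)) on an interval of length 2^-k / 2, so that
   the L^4 norm of the maximal function is at least c 2^(k(1/4 - s)), whereas
   the H^s norm of f_k stays bounded.

   The H^s norm and U(t) f_k are defined through the distributional Fourier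
   transform of f_k. Identifying it takes Fourier inversion for Schwartz
   functions and the uniqueness almost everywhere of a function representing a
   distribution. Both follow from a weak inversion formula: if h and its
   transform are integrable, then integrating the transform of h against the
   inverse transform of the indicator of [a, b] gives the integral of h over
   [a, b]. *)

Require Import Defs.
From mathcomp Require Import all_boot all_order all_algebra complex ring lra.
From mathcomp Require Import all_classical all_reals all_analysis.
From mathcomp Require Import measurable_realfun ess_sup_inf.

Import Order.TTheory GRing.Theory Num.Theory.
Import numFieldNormedType.Exports.

Local Open Scope classical_set_scope.
Local Open Scope ring_scope.

Set Implicit Arguments.
Unset Strict Implicit.
Unset Printing Implicit Defensive.

Local Notation Re := complex.Re.
Local Notation Im := complex.Im.
Local Notation normc := Normc.normc.
Local Notation leb := (@lebesgue_measure _).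
Local Notation cmeas := (@cmeasurable _ _ (measurableTypeR _)).

(** * Complex-valued integrals *)

Section ComplexNumbers.
Context {R : realType}.
Implicit Types (z w : R[i]) (r x y : R).

(** The transform of [f_k] has jumps, so [f_k] is not integrable and its transform exists only as a
    distribution. Besides, [fourier_fun] is a representative picked by choice: neither
    [sobolev_norm] nor [ostrovsky] can be computed before representatives are known to agree almost
    everywhere. Inversion is tested on intervals because the transform of [f_k] is a multiple of the
    sum of two interval indicators: for a Schwartz function [h], the weak formula is then exactly
    the pairing that defines the distributional transform. Its hypothesis on [h] is mild, since two
    derivatives of [h] already make its transform integrable. For uniqueness, the formula is applied
    to an [h] whose transform is zero, and Lebesgue differentiation recovers [h] from its integrals
    over intervals. The two conclusions measure size in time differently. One positive time makes
    the supremum large, while the essential supremum needs a set of times of positive measure; the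
    lower bound for [U(t) f_k] is therefore proved on a whole rectangle in [(x, t)]. *)

Lemma cReM z w : Re (z * w) = Re z * Re w - Im z * Im w.
Proof. by case: z w => a b [c d]. Qed.

Lemma cImM z w : Im (z * w) = Re z * Im w + Im z * Re w.
Proof. by case: z w => a b [c d]. Qed.

Lemma cReD z w : Re (z + w) = Re z + Re w. Proof. by case: z w => a b [c d]. Qed.
Lemma cImD z w : Im (z + w) = Im z + Im w. Proof. by case: z w => a b [c d]. Qed.
Lemma cReN z : Re (- z) = - Re z. Proof. by case: z. Qed.
Lemma cImN z : Im (- z) = - Im z. Proof. by case: z. Qed.

Lemma eq_complexP z w : Re z = Re w -> Im z = Im w -> z = w.
Proof. by case: z w => a b [c d] /= -> ->. Qed.

Lemma normc_ge0 z : 0 <= normc z.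
Proof. by case: z => a b; rewrite sqrtr_ge0. Qed.

Lemma Re_le_normc z : `|Re z| <= normc z.
Proof. by case: z => a b /=; rewrite -sqrtr_sqr ler_wsqrtr// lerDl sqr_ge0. Qed.

Lemma Im_le_normc z : `|Im z| <= normc z.
Proof. by case: z => a b /=; rewrite -sqrtr_sqr ler_wsqrtr// lerDr sqr_ge0. Qed.

Lemma normc_le_ReIm z : normc z <= `|Re z| + `|Im z|.
Proof.
case: z => a b /=; rewrite -[leRHS]ger0_norm ?addr_ge0// -sqrtr_sqr ler_wsqrtr//.
rewrite sqrrD !real_normK ?num_real//.
by have := mulr_ge0 (normr_ge0 a) (normr_ge0 b); lra.
Qed.

Lemma normcR r : normc (r%:C)%C = `|r|.
Proof. by rewrite /= expr0n /= addr0 sqrtr_sqr. Qed.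

Lemma normc_cexpi x : normc (cexpi x) = 1.
Proof. by rewrite /= cos2Dsin2 sqrtr1. Qed.

Lemma cexpiD x y : cexpi (x + y) = cexpi x * cexpi y.
Proof. by apply: eq_complexP; rewrite ?cReM ?cImM/= ?cosD ?sinD// addrC. Qed.

Lemma cexpi0 : cexpi (0 : R) = 1.
Proof. by rewrite /cexpi cos0 sin0. Qed.

End ComplexNumbers.

Section ComplexMeasurable.
Context d (T : measurableType d) {R : realType}.
Implicit Types (f g : T -> R[i]).

Lemma cmeasurableM f g : cmeasurable f -> cmeasurable g ->
  cmeasurable (fun x => f x * g x).
Proof.
move=> [f1 f2] [g1 g2]; split.
- under eq_fun do rewrite cReM.
  by apply: measurable_funB; exact: measurable_funM.
- under eq_fun do rewrite cImM.
  by apply: measurable_funD; exact: measurable_funM.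
Qed.

Lemma cmeasurableB f g : cmeasurable f -> cmeasurable g ->
  cmeasurable (fun x => f x - g x).
Proof.
move=> [f1 f2] [g1 g2]; split.
- under eq_fun do rewrite cReD cReN.
  exact: measurable_funB.
- under eq_fun do rewrite cImD cImN.
  exact: measurable_funB.
Qed.

Lemma cmeasurable_cst z : cmeasurable (fun _ : T => z : R[i]).
Proof. by split; exact: measurable_cst. Qed.

Lemma cmeasurableR (h : T -> R) : measurable_fun setT h ->
  cmeasurable (fun x => (h x)%:C%C).
Proof. by move=> mh; split => //=; exact: measurable_cst. Qed.

Lemma cmeasurable_cexpi (h : T -> R) : measurable_fun setT h ->
  cmeasurable (fun x => cexpi (h x)).
Proof.
move=> mh; split => /=; apply: measurableT_comp => //;
  apply: continuous_measurable_fun.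
- exact: continuous_cos.
- exact: continuous_sin.
Qed.

Lemma measurable_normc f : cmeasurable f ->
  measurable_fun setT (fun x => normc (f x)).
Proof.
move=> [f1 f2].
rewrite (_ : (fun x => _) = (@powR R ^~ 2^-1) \o
   (fun x => Re (f x) ^+ 2 + Im (f x) ^+ 2)).
  apply: (measurableT_comp (measurable_powR _)).
  by apply: measurable_funD; exact: measurable_funX.
apply/funext => x /=; case: (f x) => a b /=.
by rewrite powR12_sqrt// addr_ge0 ?sqr_ge0.
Qed.

End ComplexMeasurable.

Lemma cmeasurable_comp d1 d2 (T1 : measurableType d1) (T2 : measurableType d2)
    (R : realType) (f : T2 -> R[i]) (g : T1 -> T2) :
  measurable_fun setT g -> cmeasurable f -> cmeasurable (f \o g).
Proof.
move=> mg [f1 f2]; split.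
- exact: (measurableT_comp f1 mg).
- exact: (measurableT_comp f2 mg).
Qed.

Section ComplexIntegral.
Context {R : realType}.
Implicit Types (f g : R -> R[i]) (h : R -> R).

Lemma integrable_scale (r : R) h : leb.-integrable setT (EFin \o h) ->
  leb.-integrable setT (EFin \o (fun x => r * h x)).
Proof. by move=> ih; exact: (integrableZl measurableT r ih). Qed.

Lemma integrable_dom h u : measurable_fun setT (h : measurableTypeR R -> R) ->
  leb.-integrable setT (EFin \o u) -> (forall x, `|h x| <= u x) ->
  leb.-integrable setT (EFin \o h).
Proof.
move=> mh iu hu; apply: le_integrable iu => //; first exact/measurable_EFinP.
by move=> x _; rewrite /= lee_fin; exact: le_trans (hu x) (ler_norm _).
Qed.

Lemma cintegrable_cmeas f : cintegrable f -> cmeas f.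
Proof.
by move=> [/measurable_int f1 /measurable_int f2]; split; apply/measurable_EFinP.
Qed.

Lemma cintegrable_dom f h : cmeas f -> leb.-integrable setT (EFin \o h) ->
  (forall x, normc (f x) <= h x) -> cintegrable f.
Proof.
move=> [f1 f2] ih fh; split.
- by apply: (integrable_dom f1 ih) => x; exact: le_trans (Re_le_normc _) (fh x).
- by apply: (integrable_dom f2 ih) => x; exact: le_trans (Im_le_normc _) (fh x).
Qed.

Lemma integrable_normc f : cintegrable f ->
  leb.-integrable setT (fun x => (normc (f x))%:E).
Proof.
move=> cf; have [f1 f2] := cf.
have := integrableD measurableT (integrable_norm f1) (integrable_norm f2).
apply: le_integrable => //.
- by apply/measurable_EFinP; apply: measurable_normc; exact: cintegrable_cmeas.
- move=> x _ /=; rewrite lee_fin ger0_norm ?normc_ge0//.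
  exact: le_trans (normc_le_ReIm _) (ler_norm _).
Qed.

Lemma cintegrableMb f g (M : R) : cintegrable f -> cmeas g ->
  (forall x, normc (g x) <= M) -> cintegrable (fun x => f x * g x).
Proof.
move=> cf mg gM; apply: (@cintegrable_dom _ (fun x => M * normc (f x))).
- by apply: cmeasurableM => //; exact: cintegrable_cmeas.
- by apply: integrable_scale; exact: integrable_normc.
- by move=> x; rewrite Normc.normcM mulrC ler_wpM2r ?normc_ge0.
Qed.

Lemma cintegralZl (c : R[i]) f : cintegrable f ->
  cintegral (fun x => c * f x) = c * cintegral f.
Proof.
move=> [f1 f2]; apply: eq_complexP; rewrite /cintegral ?cReM ?cImM/=.
- under eq_Rintegral do rewrite cReM.
  by rewrite RintegralB ?RintegralZl//; exact: integrable_scale.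
- under eq_Rintegral do rewrite cImM.
  by rewrite RintegralD ?RintegralZl//; exact: integrable_scale.
Qed.

Lemma cintegralD f g : cintegrable f -> cintegrable g ->
  cintegral (fun x => f x + g x) = cintegral f + cintegral g.
Proof.
move=> [f1 f2] [g1 g2]; apply: eq_complexP; rewrite /cintegral ?cReD ?cImD/=.
- by under eq_Rintegral do rewrite cReD; rewrite RintegralD.
- by under eq_Rintegral do rewrite cImD; rewrite RintegralD.
Qed.

Lemma cintegrableD f g : cintegrable f -> cintegrable g ->
  cintegrable (fun x => f x + g x).
Proof.
move=> [f1 f2] [g1 g2]; split.
- under eq_fun do rewrite cReD EFinD; exact: integrableD.
- under eq_fun do rewrite cImD EFinD; exact: integrableD.
Qed.

Lemma cintegrableZl (c : R[i]) f : cintegrable f ->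
  cintegrable (fun x => c * f x).
Proof.
move=> cf; under eq_fun do rewrite mulrC.
by apply: (@cintegrableMb _ _ (normc c)) => //; exact: cmeasurable_cst.
Qed.

Lemma eq_cintegral f g : f =1 g -> cintegral f = cintegral g.
Proof. by move=> /funext ->. Qed.

Lemma cintegralR h : cintegral (fun x => (h x)%:C%C) = (\int[leb]_x h x)%:C%C.
Proof. by apply: eq_complexP => //=; rewrite Rintegral_cst// mul0r. Qed.

(** The factor 2 comes from bounding the real and imaginary parts separately; the value of the
    constant is immaterial in all applications. *)
Lemma normc_cintegral_le f h : cintegrable f ->
  leb.-integrable setT (EFin \o h) -> (forall x, normc (f x) <= h x) ->
  normc (cintegral f) <= 2 * \int[leb]_x h x.
Proof.
move=> [f1 f2] ih fh; apply: (le_trans (normc_le_ReIm _)) => /=.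
rewrite mulr_natl mulr2n; apply: lerD.
- apply: (le_trans (le_normr_Rintegral _ f1)) => //.
  apply: le_Rintegral => //; first exact: integrable_norm.
  by move=> x _; exact: le_trans (Re_le_normc _) (fh x).
- apply: (le_trans (le_normr_Rintegral _ f2)) => //.
  apply: le_Rintegral => //; first exact: integrable_norm.
  by move=> x _; exact: le_trans (Im_le_normc _) (fh x).
Qed.

Lemma ae_eq_cintegral f g : cmeas f -> cmeas g ->
  (\forall x \ae leb, f x = g x) -> cintegral f = cintegral g.
Proof.
move=> [f1 f2] [g1 g2] fg; apply: eq_complexP; rewrite /= /Rintegral;
  congr fine; apply: ae_eq_integral => //; do ?[exact/measurable_EFinP].
- by apply: (@filterS _ _ (ae_filter_ringOfSetsType leb)) fg => x ->.
- by apply: (@filterS _ _ (ae_filter_ringOfSetsType leb)) fg => x ->.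
Qed.

(** Tonelli's theorem gives the measurability for the positive and negative parts of [k], whether or
    not the sections of [k] are integrable. *)
Lemma measurable_Rintegral d (T : measurableType d)
    (k : T * measurableTypeR R -> R) :
  measurable_fun setT k ->
  measurable_fun setT (fun p => \int[leb]_x k (p, x)).
Proof.
move=> mk; rewrite /Rintegral.
have mfine := @fine_measurable R setT measurableT.
apply: (measurableT_comp mfine).
under eq_fun do rewrite integralE.
apply: emeasurable_funB.
- have mp : measurable_fun setT (EFin \o k)^\+%E.
    by apply: measurable_funepos; exact/measurable_EFinP.
  have mF := measurable_fun_fubini_tonelli_F (m2 := leb) _ mp (funepos_ge0 _).
  have E : fubini_F leb (EFin \o k)^\+%E =
    (fun p => \int[leb]_x (fun y => (k (p, y))%:E)^\+%E x)%E.
    by apply/funext => p; apply: eq_integral => y _; rewrite !unlock.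
  by rewrite E in mF.
- have mp : measurable_fun setT (EFin \o k)^\-%E.
    by apply: measurable_funeneg; exact/measurable_EFinP.
  have mF := measurable_fun_fubini_tonelli_F (m2 := leb) _ mp (funeneg_ge0 _).
  have E : fubini_F leb (EFin \o k)^\-%E =
    (fun p => \int[leb]_x (fun y => (k (p, y))%:E)^\-%E x)%E.
    by apply/funext => p; apply: eq_integral => y _; rewrite !unlock.
  by rewrite E in mF.
Qed.

Lemma cmeasurable_cintegral d (T : measurableType d)
    (k : T * measurableTypeR R -> R[i]) : cmeasurable k ->
  cmeasurable (fun p => cintegral (fun x => k (p, x))).
Proof.
move=> [k1 k2]; split => /=.
- exact: (measurable_Rintegral k1).
- exact: (measurable_Rintegral k2).
Qed.

End ComplexIntegral.

Section IntegralComparison.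
Context d (T : measurableType d) {R : realType} (mu : {measure set T -> \bar R}).

(* Unlike [ge0_le_integral], no measurability is required: the integral of a
   nonnegative function is a supremum over simple functions below it. *)
Lemma ge0_le_integralT (f g : T -> \bar R) :
  (forall x, 0 <= f x)%E -> (forall x, f x <= g x)%E ->
  (\int[mu]_x f x <= \int[mu]_x g x)%E.
Proof.
move=> f0 fg; rewrite !ge0_integralTE//; last first.
  by move=> x; exact: le_trans (f0 x) (fg x).
apply: ereal_sup_le => _ [h /= hf <-]; exists h => // x.
exact: le_trans (hf x) (fg x).
Qed.

End IntegralComparison.

(** * Exchange of integrals and duality for bounded kernels *)

Section Fubini.
Context {R : realType}.
Local Notation mR := (measurableTypeR R).
Implicit Types (a b : R -> R[i]).

Lemma integrable_prod_dom (f : mR * mR -> R) (u v : R -> R) :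
  measurable_fun setT f ->
  leb.-integrable setT (EFin \o u) -> leb.-integrable setT (EFin \o v) ->
  (forall x y, `|f (x, y)| <= u x * v y) ->
  (leb \x leb)%E.-integrable setT (EFin \o f).
Proof.
move=> mf iu iv fuv; apply/integrable12ltyP; first exact/measurable_EFinP.
have iuv : leb.-integrable setT (EFin \o (fun x => (\int[leb]_y v y) * u x)).
  exact: integrable_scale.
apply: le_lt_trans (integrable_lty measurableT iuv).
apply: ge0_le_integralT => [x|x]; first exact: integral_ge0.
rewrite /= [X in (_ <= X)%E](_ : _ = (\int[leb]_y (u x * v y)%:E)%E).
  by apply: ge0_le_integralT => y; rewrite /= ?lee_fin.
rewrite mulrC -RintegralZl// /Rintegral fineK//.
by apply: integrable_fin_num => //; exact: integrable_scale.
Qed.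

Lemma Rintegral_Fubini (f : mR * mR -> R) (u v : R -> R) :
  measurable_fun setT f ->
  leb.-integrable setT (EFin \o u) -> leb.-integrable setT (EFin \o v) ->
  (forall x y, `|f (x, y)| <= u x * v y) ->
  \int[leb]_x (\int[leb]_y f (x, y)) = \int[leb]_y (\int[leb]_x f (x, y)).
Proof.
move=> mf iu iv fuv.
have if12 := integrable_prod_dom mf iu iv fuv.
have fin1 x : (\int[leb]_y (f (x, y))%:E)%E \is a fin_num.
  apply: integrable_fin_num => //.
  apply: (integrable_dom (h := fun y => f (x, y)) _ (integrable_scale (u x) iv)).
    exact: (measurableT_comp mf (measurable_pair1 x)).
  by move=> y; exact: fuv.
have fin2 y : (\int[leb]_x (f (x, y))%:E)%E \is a fin_num.
  apply: integrable_fin_num => //.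
  apply: (integrable_dom (h := fun x => f (x, y)) _ (integrable_scale (v y) iu)).
    exact: (measurableT_comp mf (measurable_pair2 y)).
  by move=> x; rewrite mulrC; exact: fuv.
rewrite /Rintegral; congr fine.
transitivity (\int[leb]_x \int[leb]_y (EFin \o f) (x, y))%E.
  by apply: eq_integral => x _; rewrite /= fineK.
by rewrite Fubini//; apply: eq_integral => y _; rewrite /= fineK.
Qed.

Lemma cintegral_Fubini (k : mR * mR -> R[i]) (u v : R -> R) :
  cmeasurable k ->
  leb.-integrable setT (EFin \o u) -> leb.-integrable setT (EFin \o v) ->
  (forall x y, normc (k (x, y)) <= u x * v y) ->
  cintegral (fun x => cintegral (fun y => k (x, y))) =
  cintegral (fun y => cintegral (fun x => k (x, y))).
Proof.
move=> [k1 k2] iu iv kuv; apply: eq_complexP => /=.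
- apply: (Rintegral_Fubini k1 iu iv) => x y.
  exact: le_trans (Re_le_normc _) (kuv x y).
- apply: (Rintegral_Fubini k2 iu iv) => x y.
  exact: le_trans (Im_le_normc _) (kuv x y).
Qed.

Lemma cintegrable_kernel2 (k : mR * mR -> R[i]) a y :
  cmeasurable k -> (forall p, normc (k p) <= 1) -> cintegrable a ->
  cintegrable (fun x => k (x, y) * a x).
Proof.
move=> mk k1 ia; under eq_fun do rewrite mulrC.
apply: (@cintegrableMb _ _ _ 1) => //.
exact: (cmeasurable_comp (measurable_pair2 y) mk).
Qed.

Lemma cintegrable_kernel1 (k : mR * mR -> R[i]) b x :
  cmeasurable k -> (forall p, normc (k p) <= 1) -> cintegrable b ->
  cintegrable (fun y => k (x, y) * b y).
Proof.
move=> mk k1 ib; under eq_fun do rewrite mulrC.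
apply: (@cintegrableMb _ _ _ 1) => //.
exact: (cmeasurable_comp (measurable_pair1 x) mk).
Qed.

(* Both sides are the double integral of [a x * k (x, y) * b y]. *)
Lemma kernel_duality (k : mR * mR -> R[i]) a b :
  cmeasurable k -> (forall p, normc (k p) <= 1) ->
  cintegrable a -> cintegrable b ->
  cintegral (fun x => a x * cintegral (fun y => k (x, y) * b y)) =
  cintegral (fun y => b y * cintegral (fun x => k (x, y) * a x)).
Proof.
move=> mk k1 ia ib.
rewrite (eq_cintegral (g := fun x => cintegral (fun y =>
    a x * (k (x, y) * b y)))); last first.
  by move=> x; rewrite cintegralZl//; exact: cintegrable_kernel1.
rewrite (eq_cintegral (f := fun y => b y * _) (g := fun y =>
    cintegral (fun x => a x * (k (x, y) * b y)))); last first.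
  move=> y; rewrite -cintegralZl; last exact: cintegrable_kernel2.
  by apply: eq_cintegral => x; rewrite mulrCA mulrA mulrC mulrA.
have /= := @cintegral_Fubini (fun p => a p.1 * (k p * b p.2))
  (fun x => normc (a x)) (fun y => normc (b y)).
apply.
- apply: cmeasurableM.
    exact: (cmeasurable_comp measurable_fst (cintegrable_cmeas ia)).
  apply: cmeasurableM => //.
  exact: (cmeasurable_comp measurable_snd (cintegrable_cmeas ib)).
- exact: integrable_normc.
- exact: integrable_normc.
- move=> x y /=; rewrite !Normc.normcM ler_wpM2l ?normc_ge0//.
  by rewrite ler_piMl ?normc_ge0.
Qed.

End Fubini.

Section DominatedConvergence.
Context {R : realType}.

Lemma Rintegral_dominated (F : R -> R) (r_ : nat -> R -> R) (r : R -> R) (M : R) :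
  leb.-integrable setT (EFin \o F) ->
  (forall n, measurable_fun setT (r_ n : measurableTypeR R -> R)) ->
  measurable_fun setT (r : measurableTypeR R -> R) ->
  (forall n x, `|r_ n x| <= M) ->
  (\forall x \ae leb, r_ n x @[n --> \oo] --> r x) ->
  \int[leb]_x (F x * r_ n x) @[n --> \oo] --> \int[leb]_x (F x * r x).
Proof.
move=> iF mr_ mr rM rr.
have mF : measurable_fun setT (F : measurableTypeR R -> R).
  by apply/measurable_EFinP; exact: measurable_int iF.
have [] := @dominated_convergence _ _ R leb setT measurableT
  (fun n x => (F x * r_ n x)%:E) (fun x => (F x * r x)%:E)
  (fun x => (M * `|F x|)%:E).
- by move=> n; apply/measurable_EFinP; exact: measurable_funM.
- by apply/measurable_EFinP; exact: measurable_funM.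
- apply: (@filterS _ _ (ae_filter_ringOfSetsType leb)) rr => x rrx _.
  apply/cvg_EFin; first exact: nearW.
  by apply: cvgM; [exact: cvg_cst|].
- by apply: integrable_scale; exact: integrable_norm.
- apply: (aeW leb) => x n _ /=.
  by rewrite lee_fin normrM mulrC ler_wpM2r.
move=> i1 _.
by rewrite -(fineK (integrable_fin_num measurableT i1)) => /fine_cvgP[].
Qed.

(** Convergence is stated for the real and imaginary parts, so that all limits are taken in [R]. *)
Lemma cintegral_dominated (F : R -> R[i]) (r_ : nat -> R -> R) (r : R -> R)
    (M : R) :
  cintegrable F ->
  (forall n, measurable_fun setT (r_ n : measurableTypeR R -> R)) ->
  measurable_fun setT (r : measurableTypeR R -> R) ->
  (forall n x, `|r_ n x| <= M) ->
  (\forall x \ae leb, r_ n x @[n --> \oo] --> r x) ->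
  (Re (cintegral (fun x => F x * (r_ n x)%:C%C)) @[n --> \oo] -->
    Re (cintegral (fun x => F x * (r x)%:C%C))) /\
  (Im (cintegral (fun x => F x * (r_ n x)%:C%C)) @[n --> \oo] -->
    Im (cintegral (fun x => F x * (r x)%:C%C))).
Proof.
move=> [F1 F2] mr_ mr rM rr; split.
- have := Rintegral_dominated F1 mr_ mr rM rr.
  have E s : Re (cintegral (fun x => F x * (s x)%:C%C)) =
             \int[leb]_x (Re (F x) * s x).
    by apply: eq_Rintegral => x _; rewrite cReM/= mulr0 subr0.
  by rewrite E; under [X in _ -> X @ _ --> _]funext do rewrite E.
- have := Rintegral_dominated F2 mr_ mr rM rr.
  have E s : Im (cintegral (fun x => F x * (s x)%:C%C)) =
             \int[leb]_x (Im (F x) * s x).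
    by apply: eq_Rintegral => x _; rewrite cImM/= mulr0 add0r.
  by rewrite E; under [X in _ -> X @ _ --> _]funext do rewrite E.
Qed.

End DominatedConvergence.

(** * Integrals over the line and the Poisson kernel *)

Section WholeLine.
Context {R : realType}.
Implicit Types (f g G : R -> R).

(** This function is the majorant used throughout: for the damping exponentials, for Schwartz
    functions and for their transforms. *)
Lemma integrable_oneDsqrV :
  leb.-integrable setT (EFin \o (fun x : R => (1 + x ^+ 2)^-1)).
Proof.
apply/integrableP; split.
  apply/measurable_EFinP; apply: continuous_measurable_fun.
  exact: continuous_oneDsqrV.
under eq_integral do rewrite gee0_abs ?lee_fin ?invr_ge0 ?addr_ge0 ?sqr_ge0//.
rewrite (ge0_symfun_integralT (f := fun x : R => (1 + x ^+ 2)^-1)).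
- by rewrite -set_itvcy integral0y_oneDsqr -EFinM ltry.
- by move=> x; rewrite invr_ge0 addr_ge0 ?sqr_ge0.
- exact: continuous_oneDsqrV.
- by move=> x /=; rewrite sqrrN.
Qed.

Lemma cvg0_oneDsqrV (C : R) (a : nat -> R) :
  (forall n, `|a n| <= C * (1 + n%:R ^+ 2)^-1) -> a n @[n --> \oo] --> 0.
Proof.
move=> aC; apply/norm_cvg0P.
have C0 : 0 <= C.
  by have := le_trans (normr_ge0 _) (aC 0%N); rewrite expr0n addr0 invr1 mulr1.
apply: (@squeeze_cvgr _ _ _ _ (cst 0) (fun n => (C * 2) * n.+1%:R^-1)).
- apply: nearW => n; rewrite normr_ge0 /=; apply: le_trans (aC n) _.
  rewrite -mulrA ler_wpM2l// -[leRHS]invrK lef_pV2 ?posrE ?invr_gt0 ?mulr_gt0//.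
  rewrite invfM invrK -(natr1 n); have : (0 : R) <= n%:R by [].
  (* What remains is [(n + 1) / 2 <= 1 + n^2], a consequence of [(n - 1/4)^2 >= 0]. *)
  by move: (n%:R) => y y0; have := sqr_ge0 (y - 1 / 4); rewrite !expr2; lra.
- exact: cvg_cst.
- rewrite -(mulr0 (C * 2)); apply: cvgM; first exact: cvg_cst.
  exact: cvg_harmonic.
Qed.

Lemma Rintegral_indic_mul f (A : set R) :
  \int[leb]_(x in A) f x = \int[leb]_x (f x * \1_A x).
Proof.
rewrite Rintegral_mkcond; apply: eq_Rintegral => x _.
by rewrite patchE indicE; case: ifP => _; rewrite ?mulr1 ?mulr0.
Qed.

Lemma Rintegral_cvg_itv f : leb.-integrable setT (EFin \o f) ->
  \int[leb]_(x in `[- n%:R, n%:R]) f x @[n --> \oo] --> \int[leb]_x f x.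
Proof.
move=> intf.
have <- : \int[leb]_x (f x * 1) = \int[leb]_x f x.
  by apply: eq_Rintegral => x _; rewrite mulr1.
under eq_cvg do rewrite Rintegral_indic_mul.
apply: (Rintegral_dominated (M := 1) intf).
- by move=> n; exact: measurable_indic.
- exact: measurable_cst.
- by move=> n x; rewrite indicE ger0_norm// lern1 leq_b1.
- apply: (aeW leb) => x; apply: (@cvg_near_cst _ _ _ _ _ _).
  near=> n; rewrite indicE mem_set//= in_itv/= -ler_norml.
  by near: n; exact: nbhs_infty_ger.
Unshelve. all: by end_near. Qed.

Lemma Rintegral_FTC2 f G (a b : R) : a < b ->
  (forall x : R, is_derive x 1 G (f x)) -> continuous f ->
  \int[leb]_(x in `[a, b]) f x = G b - G a.
Proof.
move=> ab dG cf; rewrite /Rintegral (continuous_FTC2 (F := G) ab)//.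
- exact: continuous_subspaceT.
- have cG x : {for x, continuous G}.
    by apply/differentiable_continuous/derivable1_diffP; apply: ex_derive.
  split.
  + by move=> x _; apply: ex_derive.
  + by apply: cvg_at_right_filter; exact: cG.
  + by apply: cvg_at_left_filter; exact: cG.
- by move=> x _; rewrite derive1E derive_val.
Qed.

(** Meant for integrands in [exp (- e |x|)], which have a corner at 0: each half-line gets its own
    smooth extension and antiderivative. As [f] is integrable, the limit over [[-n, n]] determines
    the integral. *)
Lemma Rintegral_glue f f1 f2 A1 A2 (l : R) :
  leb.-integrable setT (EFin \o f) ->
  (forall x : R, is_derive x 1 A1 (f1 x)) -> continuous f1 ->
  (forall x : R, is_derive x 1 A2 (f2 x)) -> continuous f2 ->
  (forall x, 0 <= x -> f x = f1 x) -> (forall x, x <= 0 -> f x = f2 x) ->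
  (A1 n%:R - A1 0) + (A2 0 - A2 (- n%:R)) @[n --> \oo] --> l ->
  \int[leb]_x f x = l.
Proof.
move=> intf dA1 cf1 dA2 cf2 ff1 ff2 Al.
have hR := @Rhausdorff R.
rewrite -(cvg_lim hR (Rintegral_cvg_itv intf)); apply: (cvg_lim hR).
apply: cvg_trans Al; apply: near_eq_cvg; near=> n.
have n0 : (0 : R) < n%:R by near: n; exact: nbhs_infty_gtr.
have inti (i : interval R) : leb.-integrable [set` i] (EFin \o f).
  by apply: integrableS intf.
rewrite -(Rintegral_FTC2 n0 dA1 cf1).
have n0' : - n%:R < (0 : R) by rewrite oppr_lt0.
rewrite -(Rintegral_FTC2 n0' dA2 cf2).
have <- : \int[leb]_(x in `[0, n%:R]) f x = \int[leb]_(x in `[0, n%:R]) f1 x.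
  by apply: eq_Rintegral => x; rewrite inE/= in_itv/= => /andP[/ff1].
have <- : \int[leb]_(x in `[- n%:R, 0]) f x =
          \int[leb]_(x in `[- n%:R, 0]) f2 x.
  by apply: eq_Rintegral => x; rewrite inE/= in_itv/= => /andP[_ /ff2].
apply/eqP; rewrite eq_sym -subr_eq; apply/eqP.
rewrite Rintegral_itvB ?bnd_simp ?(ltW n0) ?(ltW n0')//.
by rewrite Rintegral_itv_obnd_cbnd.
Unshelve. all: by end_near. Qed.

Lemma Rintegral_derive0 g G (C : R) :
  leb.-integrable setT (EFin \o g) ->
  (forall x : R, is_derive x 1 G (g x)) -> continuous g ->
  (forall x, `|G x| <= C * (1 + x ^+ 2)^-1) ->
  \int[leb]_x g x = 0.
Proof.
move=> intg dG cg GC.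
apply: (Rintegral_glue (f1 := g) (f2 := g) intg dG _ dG) => //.
rewrite (_ : (fun n => _) = (fun n => G n%:R - G (- n%:R))); last first.
  by apply/funext => n; rewrite addrA subrK.
rewrite -(subr0 0); apply: cvgB; apply: (@cvg0_oneDsqrV C) => n //.
by rewrite -[n%:R ^+ 2]sqrrN.
Qed.

End WholeLine.

Section Poisson.
Context {R : realType}.
Implicit Types (c u e x : R).

Lemma is_derive_scaled (f f' : R -> R) c x :
  (forall y : R, is_derive y 1 f (f' y)) ->
  is_derive x 1 (fun y => f (c * y)) (c * f' (c * x)).
Proof.
move=> df; have dl : is_derive x 1 (fun y : R => c * y) c.
  by apply: is_derive_eq; rewrite /GRing.scale/= mulr1.
by rewrite mulrC; exact: (is_derive1_comp (df _) dl).
Qed.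

Definition is_derive_cosM c x := is_derive_scaled c x (@is_derive_cos R).
Definition is_derive_sinM c x := is_derive_scaled c x (@is_derive_sin R).
Definition is_derive_expRM c x := is_derive_scaled c x (@is_derive_expR R).
Existing Instances is_derive_cosM is_derive_sinM is_derive_expRM.

Lemma continuousP_derive (f f' : R -> R) :
  (forall y : R, is_derive y 1 f (f' y)) -> continuous f.
Proof.
move=> df x; apply/differentiable_continuous/derivable1_diffP.
exact: ex_derive.
Qed.

(** Up to a factor these are antiderivatives: with [D = e^2 + u^2], the derivative of [A e u] is
    [D exp (- e x) cos (u x)] and that of [B e u] is [- D exp (- e x) sin (u x)]. Replacing [e] by
    [- e] serves the negative half-line. *)
Let A e u x : R := expR (- e * x) * (u * sin (u * x) - e * cos (u * x)).
Let B e u x : R := expR (- e * x) * (e * sin (u * x) + u * cos (u * x)).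

(** Put [z = e |x|]. Squaring [exp (z / 2) >= 1 + z / 2] gives [exp z >= 1 + z^2 / 4], and [e <= 2]
    bounds [e^2 / 4] by 1, so that [exp z >= (e^2 / 4) (1 + x^2)]. *)
Lemma expRN_le_oneDsqrV e x : 0 < e -> e <= 2 ->
  expR (- (e * `|x|)) <= (4 / e ^+ 2) * (1 + x ^+ 2)^-1.
Proof.
move=> e0 e2; rewrite -[4 / _]invf_div -invfM expRN.
rewrite lef_pV2 ?posrE ?expR_gt0//.
  rewrite -(real_normK (num_real x)); set y := `|x|.
  have y0 : 0 <= y by exact: normr_ge0.
  have h : 1 + e * y / 2 <= expR (e * y / 2) by exact: expR_ge1Dx.
  have -> : expR (e * y) = expR (e * y / 2) ^+ 2.
    by rewrite -expRM_natl; congr expR; field.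
  have ey : 0 <= e * y by rewrite mulr_ge0// ltW.
  apply: (@le_trans _ _ ((1 + e * y / 2) ^+ 2)); last first.
    by rewrite ler_pXn2r// ?nnegrE ?expR_ge0// addr_ge0// divr_ge0.
  have : e ^+ 2 / 4 <= 1 by rewrite expr2; nra.
  move: ey; set z := e * y => z0 e1.
  have -> : e ^+ 2 / 4 * (1 + y ^+ 2) = e ^+ 2 / 4 + z ^+ 2 / 4.
    by rewrite /z; field.
  rewrite !expr2; nra.
by rewrite mulr_gt0 ?invr_gt0 ?divr_gt0 ?exprn_gt0 ?ltr_wpDr ?sqr_ge0.
Qed.

Lemma measurable_expN_abs e :
  measurable_fun setT (fun x : measurableTypeR R => expR (- (e * `|x|))).
Proof.
apply: (measurableT_comp (@measurable_expR R)).
apply: (measurableT_comp (@oppr_measurable R setT)).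
exact: (measurableT_comp (@mulrl_measurable R setT e) (@normr_measurable R setT)).
Qed.

Lemma integrable_expN_abs e : 0 < e -> e <= 2 ->
  leb.-integrable setT (EFin \o (fun x => expR (- (e * `|x|)))).
Proof.
move=> e0 e2.
apply: (integrable_dom _ (integrable_scale (4 / e ^+ 2) integrable_oneDsqrV)).
  exact: measurable_expN_abs.
by move=> x; rewrite ger0_norm ?expR_ge0// expRN_le_oneDsqrV.
Qed.

Let A_le e u (x : R) : `|A e u x| <= expR (- e * x) * (`|u| + `|e|).
Proof.
rewrite /A normrM ger0_norm ?expR_ge0// ler_wpM2l ?expR_ge0//.
apply: le_trans (ler_normB _ _) _; rewrite !normrM; apply: lerD.
- by rewrite ler_piMr// sin_max.
- by rewrite ler_piMr// cos_max.
Qed.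

Let B_le e u (x : R) : `|B e u x| <= expR (- e * x) * (`|u| + `|e|).
Proof.
rewrite /B normrM ger0_norm ?expR_ge0// ler_wpM2l ?expR_ge0//.
apply: le_trans (ler_normD _ _) _; rewrite !normrM addrC; apply: lerD.
- by rewrite ler_piMr// cos_max.
- by rewrite ler_piMr// sin_max.
Qed.

Let cvg_boundary e u (F : R -> R -> R -> R) : 0 < e -> e <= 2 ->
  (forall e' x, `|F e' u x| <= expR (- e' * x) * (`|u| + `|e'|)) ->
  F e u n%:R - F (- e) u (- n%:R) @[n --> \oo] --> 0.
Proof.
move=> e0 e2 FE; apply: (@cvg0_oneDsqrV _ (2 * (`|u| + `|e|) * (4 / e ^+ 2))) => n.
apply: le_trans (ler_normB _ _) _.
have h := @expRN_le_oneDsqrV e n%:R e0 e2.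
rewrite ger0_norm// in h.
have K0 : 0 <= `|u| + `|e| by rewrite addr_ge0.
have h1 := FE e n%:R; have h2 := FE (- e) (- n%:R).
rewrite mulrNN normrN mulNr in h2; rewrite mulNr in h1.
apply: le_trans (lerD h1 h2) _.
have := ler_wpM2r K0 h; move: (4 / _) (expR _) => p q; lra.
Qed.

Let D_neq0 e u : 0 < e -> e ^+ 2 + u ^+ 2 != 0.
Proof. by move=> e0; rewrite gt_eqF// ltr_wpDr ?sqr_ge0// exprn_gt0. Qed.

Lemma poisson_cos e u : 0 < e -> e <= 2 ->
  \int[leb]_x (expR (- (e * `|x|)) * cos (u * x)) = 2 * e / (e ^+ 2 + u ^+ 2).
Proof.
move=> e0 e2; have D0 := D_neq0 u e0; set D := e ^+ 2 + u ^+ 2 in D0 *.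
apply: (Rintegral_glue (f1 := fun x => expR (- e * x) * cos (u * x))
   (f2 := fun x => expR (- - e * x) * cos (u * x))
   (A1 := fun x => D^-1 * A e u x) (A2 := fun x => D^-1 * A (- e) u x)).
- apply: (integrable_dom _ (integrable_expN_abs e0 e2)) => [|x].
    apply: measurable_funM; first exact: measurable_expN_abs.
    apply: continuous_measurable_fun; apply: continuousP_derive => y.
  by rewrite normrM ger0_norm ?expR_ge0// ler_piMr ?expR_ge0// cos_max.
- move=> x; apply: is_derive_eq; rewrite /GRing.scale/=.
  by apply: (canLR (mulKf D0)); rewrite /D; ring.
- by apply: continuousP_derive => y.
- move=> x; apply: is_derive_eq; rewrite /GRing.scale/=.
  by apply: (canLR (mulKf D0)); rewrite /D; ring.
- by apply: continuousP_derive => y.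
- by move=> x x0; rewrite ger0_norm// mulNr.
- by move=> x x0; rewrite ler0_norm// mulrN !opprK.
(* The boundary terms at infinity vanish, and each of the two antiderivatives contributes [e / D] at
   0. For the sine below, the two contributions at 0 cancel. *)
- rewrite (_ : (fun n => _) = fun n => D^-1 * (A e u n%:R - A (- e) u (- n%:R))
      + 2 * e / D); last first.
    apply/funext => n; rewrite /A !mulr0 sin0 cos0 expR0; field; exact: D0.
  have : D^-1 * (A e u n%:R - A (- e) u (- n%:R)) + 2 * e / D @[n --> \oo]
      --> D^-1 * 0 + 2 * e / D.
    by apply: cvgD; [apply: cvgM; [exact: cvg_cst|exact: cvg_boundary]|
      exact: cvg_cst].
  by rewrite mulr0 add0r.
Qed.

Lemma poisson_sin e u : 0 < e -> e <= 2 ->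
  \int[leb]_x (expR (- (e * `|x|)) * sin (u * x)) = 0.
Proof.
move=> e0 e2; have D0 := D_neq0 u e0; set D := e ^+ 2 + u ^+ 2 in D0 *.
have ND0 : - D != 0 by rewrite oppr_eq0.
apply: (Rintegral_glue (f1 := fun x => expR (- e * x) * sin (u * x))
   (f2 := fun x => expR (- - e * x) * sin (u * x))
   (A1 := fun x => (- D)^-1 * B e u x) (A2 := fun x => (- D)^-1 * B (- e) u x)).
- apply: (integrable_dom _ (integrable_expN_abs e0 e2)) => [|x].
    apply: measurable_funM; first exact: measurable_expN_abs.
    apply: continuous_measurable_fun; apply: continuousP_derive => y.
  by rewrite normrM ger0_norm ?expR_ge0// ler_piMr ?expR_ge0// sin_max.
- move=> x; apply: is_derive_eq; rewrite /GRing.scale/=.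
  by apply: (canLR (mulKf ND0)); rewrite /D; ring.
- by apply: continuousP_derive => y.
- move=> x; apply: is_derive_eq; rewrite /GRing.scale/=.
  by apply: (canLR (mulKf ND0)); rewrite /D; ring.
- by apply: continuousP_derive => y.
- by move=> x x0; rewrite ger0_norm// mulNr.
- by move=> x x0; rewrite ler0_norm// mulrN !opprK.
- rewrite (_ : (fun n => _) = fun n =>
      (- D)^-1 * (B e u n%:R - B (- e) u (- n%:R))); last first.
    apply/funext => n; rewrite /B !mulr0 sin0 cos0 expR0; field; exact: D0.
  have : (- D)^-1 * (B e u n%:R - B (- e) u (- n%:R)) @[n --> \oo]
      --> (- D)^-1 * 0.
    by apply: cvgM; [exact: cvg_cst|exact: cvg_boundary].
  by rewrite mulr0.
Qed.

Lemma poisson_kernel e u : 0 < e -> e <= 2 ->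
  cintegral (fun x => cexpi (u * x) * (expR (- (e * `|x|)))%:C%C) =
  (2 * e / (e ^+ 2 + u ^+ 2))%:C%C.
Proof.
move=> e0 e2; apply: eq_complexP => /=.
- rewrite -poisson_cos//; apply: eq_Rintegral => x _.
  by rewrite mulr0 subr0 mulrC.
- rewrite -[RHS](poisson_sin u e0 e2); apply: eq_Rintegral => x _.
  by rewrite mulr0 add0r mulrC.
Qed.

End Poisson.

(** * Weak Fourier inversion *)

Section WeakInversion.
Context {R : realType}.
Local Notation mR := (measurableTypeR R).

Lemma cvg_atan_scaled (c : R) : 0 < c ->
  atan (c * n.+1%:R) @[n --> \oo] --> pi / 2.
Proof.
move=> c0; apply: (cvg_comp (fun n => c * n.+1%:R) atan _ (@cvgy_atan R)).
apply/cvgryPge => A; near=> n.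
rewrite mulrC -ler_pdivrMr//; apply: (@le_trans _ _ n%:R); last by rewrite ler_nat.
by near: n; exact: nbhs_infty_ger.
Unshelve. all: by end_near. Qed.

Lemma cvg_atan_scaledN (c : R) : c < 0 ->
  atan (c * n.+1%:R) @[n --> \oo] --> - (pi / 2).
Proof.
move=> c0; have -> : (fun n => atan (c * n.+1%:R)) =
    (fun n => - atan (- c * n.+1%:R)).
  by apply/funext => n; rewrite mulNr atanN opprK.
by apply: cvgN; apply: cvg_atan_scaled; rewrite oppr_gt0.
Qed.

(** The integral over [[a, b]] of the Poisson kernel centred at [y] with parameter [1 / (n + 1)], in
    closed form (see [poisson_itv]). Its two merits are the bound [2 * pi], uniform in [n] and [y],
    and an explicit pointwise limit. *)
Let step (a b : R) (n : nat) (y : R) : R :=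
  2 * (atan ((b - y) * n.+1%:R) - atan ((a - y) * n.+1%:R)).

Let measurable_step a b n : measurable_fun setT (step a b n : mR -> R).
Proof.
have m c : measurable_fun setT (fun y : mR => atan ((c - y) * n.+1%:R)).
  apply: continuous_measurable_fun => x.
  apply: (@continuous_comp _ _ _ (fun y : R => (c - y) * n.+1%:R) atan).
    apply: cvgM; last exact: cvg_cst.
    by apply: cvgB; [exact: cvg_cst|exact: cvg_id].
  exact: continuous_atan.
exact: (measurable_funM (measurable_cst (2 : R)) (measurable_funB (m b) (m a))).
Qed.

Let step_le a b n y : `|step a b n y| <= 2 * pi.
Proof.
rewrite normrM ger0_norm// ler_wpM2l//.
have h (z : R) : `|atan z| <= pi / 2.
  by rewrite ler_norml (ltW (atan_gtNpi2 z)) (ltW (atan_ltpi2 z)).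
by apply: le_trans (ler_normB _ _) _; rewrite [leRHS]splitr lerD.
Qed.

(** Each arctangent tends to [pi / 2] or [- pi / 2] according to the side on which [y] lies. At an
    endpoint one of them is 0 and the limit is [pi], hence the two excluded points, which form a
    null set. *)
Let cvg_step a b (y : R) : a < b -> y != a -> y != b ->
  step a b n y @[n --> \oo] --> 2 * pi * \1_`[a, b]%classic y.
Proof.
move=> ab ya yb.
have [ya'|ay] := ltP y a.
  have -> : 2 * pi * \1_`[a, b]%classic y = 2 * (pi / 2 - pi / 2) :> R.
    by rewrite indicE memNset ?mulr0 ?subrr ?mulr0//= in_itv/= leNgt ya'.
  apply: cvgM; first exact: cvg_cst.
  by apply: cvgB; apply: cvg_atan_scaled; rewrite subr_gt0// (lt_trans ya').
have {ya ay} ay : a < y by rewrite lt_neqAle eq_sym ya.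
have [yb'|by'] := ltP y b.
  have -> : 2 * pi * \1_`[a, b]%classic y = 2 * (pi / 2 - - (pi / 2)) :> R.
    rewrite indicE mem_set/= ?in_itv/= ?(ltW ay) ?(ltW yb')// mulr1.
    by rewrite opprK -splitr.
  apply: cvgM; first exact: cvg_cst.
  apply: cvgB; first by apply: cvg_atan_scaled; rewrite subr_gt0.
  by apply: cvg_atan_scaledN; rewrite subr_lt0.
have {yb by'} by' : b < y by rewrite lt_neqAle eq_sym yb.
have -> : 2 * pi * \1_`[a, b]%classic y = 2 * (- (pi / 2) - - (pi / 2)) :> R.
  rewrite indicE memNset ?mulr0 ?subrr ?mulr0//= in_itv/= [y <= b]leNgt by'.
  by rewrite andbF.
apply: cvgM; first exact: cvg_cst.
by apply: cvgB; apply: cvg_atan_scaledN; rewrite subr_lt0.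
Qed.

Let poisson_itv a b n y : a < b ->
  \int[leb]_x (\1_`[a, b]%classic x *
    (2 * n.+1%:R^-1 / (n.+1%:R^-1 ^+ 2 + (x - y) ^+ 2))) = step a b n y.
Proof.
move=> ab; under eq_Rintegral do rewrite mulrC.
rewrite -Rintegral_indic_mul.
pose G (x : R) : R := 2 * atan (n.+1%:R * (x - y)).
have n0 : n.+1%:R != 0 :> R by rewrite pnatr_eq0.
have p x : 1 + (n.+1%:R * (x - y)) ^+ 2 != 0 :> R.
  by rewrite gt_eqF// ltr_wpDr ?sqr_ge0.
have dG (x : R) : is_derive x 1 G
    (2 * n.+1%:R^-1 / (n.+1%:R^-1 ^+ 2 + (x - y) ^+ 2)).
  have dl : is_derive x 1 (fun x : R => n.+1%:R * (x - y)) (n.+1%:R : R).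
    by apply: is_derive_eq; rewrite /GRing.scale/= subr0 mulr1.
  have da := @is_derive1_comp R atan (fun x => n.+1%:R * (x - y)) x _ _
    (is_derive1_atan _) dl.
  have := is_deriveZ (2 : R) da.
  rewrite /GRing.scale/= => d2; apply: is_derive_eq.
  have q := p x; move: n0 q; move: (n.+1%:R) (x - y) => N z n0 q.
  by field; rewrite n0 /= mulrC.
rewrite (Rintegral_FTC2 ab dG) /G /step.
  by rewrite [RHS]mulrBr ![_ * n.+1%:R]mulrC.
move=> x; apply: cvgM; first exact: cvg_cst.
have q : n.+1%:R^-1 ^+ 2 + (x - y) ^+ 2 != 0 :> R.
  by rewrite gt_eqF// ltr_wpDr ?sqr_ge0// exprn_gt0 ?invr_gt0.
apply: cvgV => //; apply: cvgD; first exact: cvg_cst.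
by apply: cvgM; (apply: cvgB; [exact: cvg_id|exact: cvg_cst]).
Qed.

(** The factors [1 / sqrt (2 pi)] are left out of both transforms, whence the [2 * pi] in
    [weak_inversion]. *)
Let F (h : R -> R[i]) (x : R) := cintegral (fun y => cexpi (- (y * x)) * h y).
Let m (a b x : R) :=
  cintegral (fun y => cexpi (x * y) * (\1_`[a, b]%classic y)%:C%C).

Lemma cmeasurable_cexpi_prod :
  cmeasurable (fun p : mR * mR => cexpi (p.1 * p.2)).
Proof.
apply: cmeasurable_cexpi.
by apply: measurable_funM; [exact: measurable_fst|exact: measurable_snd].
Qed.

Lemma cmeasurable_cexpi_prodN :
  cmeasurable (fun p : mR * mR => cexpi (- (p.2 * p.1))).
Proof.
apply: cmeasurable_cexpi; apply: measurable_funN.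
by apply: measurable_funM; [exact: measurable_snd|exact: measurable_fst].
Qed.

Lemma cintegrable_indic_itv (a b : R) :
  cintegrable (fun y => (\1_`[a, b]%classic y)%:C%C).
Proof.
split => /=; first exact: integrable_indic_itv.
exact: integrable0.
Qed.

Lemma cintegrable_cexpi_mul (u : R -> R) (f : R -> R[i]) :
  measurable_fun setT (u : mR -> R) ->
  cintegrable f -> cintegrable (fun y => cexpi (u y) * f y).
Proof.
move=> mu cf; under eq_fun do rewrite mulrC.
apply: (@cintegrableMb _ _ _ 1) => //.
  exact: (cmeasurable_cexpi mu).
by move=> y; rewrite normc_cexpi.
Qed.

Lemma cintegrable_inv_fourier_ker (f : R -> R[i]) (x : R) :
  cintegrable f -> cintegrable (fun y => cexpi (x * y) * f y).
Proof.
apply: cintegrable_cexpi_mul.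
exact: mulrl_measurable.
Qed.

Lemma cmeasurable_inv_fourier_ker (f : R -> R[i]) :
  cmeas f -> cmeas (fun x => cintegral (fun y => cexpi (x * y) * f y)).
Proof.
move=> mf; apply: (cmeasurable_cintegral
  (k := fun p : mR * mR => cexpi (p.1 * p.2) * f p.2)).
apply: cmeasurableM; first exact: cmeasurable_cexpi_prod.
exact: (cmeasurable_comp measurable_snd mf).
Qed.

Lemma cmeasurable_fourier_ker (f : R -> R[i]) :
  cmeas f -> cmeas (fun x => cintegral (fun y => cexpi (- (y * x)) * f y)).
Proof.
move=> mf; apply: (cmeasurable_cintegral
  (k := fun p : mR * mR => cexpi (- (p.2 * p.1)) * f p.2)).
apply: cmeasurableM; first exact: cmeasurable_cexpi_prodN.
exact: (cmeasurable_comp measurable_snd mf).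
Qed.

Lemma normc_inv_fourier_ker_le (f : R -> R[i]) (x : R) : cintegrable f ->
  normc (cintegral (fun y => cexpi (x * y) * f y)) <=
    2 * \int[leb]_y normc (f y).
Proof.
move=> cf; apply: normc_cintegral_le.
- exact: cintegrable_inv_fourier_ker.
- exact: integrable_normc.
- by move=> y; rewrite Normc.normcM normc_cexpi mul1r.
Qed.

(* Abel summation: multiplying by [exp (- |x| / n)] turns the inner integral
   into the integral over [a, b] of a Poisson kernel, an explicit difference of
   arctangents which tends to the indicator of [a, b]. *)
Lemma weak_inversion (h : R -> R[i]) (a b : R) : a < b ->
  cintegrable h -> cintegrable (F h) ->
  cintegral (fun x => F h x * m a b x) =
  (2 * pi)%:C%C * cintegral (fun y => h y * (\1_`[a, b]%classic y)%:C%C).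
Proof.
move=> ab ih iF.
pose e n (x : R) : R := expR (- (n.+1%:R^-1 * `|x|)).
have en0 n : (0 : R) < n.+1%:R^-1 by rewrite invr_gt0.
have en2 n : n.+1%:R^-1 <= (2 : R).
  by apply: (@le_trans _ _ 1); rewrite ?invf_le1 ?ler1n.
have e1 n x : `|e n x| <= 1.
  by rewrite ger0_norm ?expR_ge0// -expR0 ler_expR oppr_le0 mulr_ge0// ltW.
have me n : cmeas (fun x => (e n x)%:C%C).
  exact: (cmeasurableR (measurable_expN_abs _)).
have ie n : cintegrable (fun x => (e n x)%:C%C).
  split => /=; first exact: integrable_expN_abs.
  exact: integrable0.
pose M : R := 2 * \int[leb]_y normc (\1_`[a, b]%classic y)%:C%C.
have ii := cintegrable_indic_itv a b.
have mM x : normc (m a b x) <= M by exact: normc_inv_fourier_ker_le.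
have mm : cmeas (m a b).
  exact: (cmeasurable_inv_fourier_ker (cintegrable_cmeas ii)).
have iFm : cintegrable (fun x => F h x * m a b x).
  exact: (cintegrableMb iF mm mM).
(* This is what the damping is for: [m a b] decays only like [1 / |x|], whereas [kernel_duality]
   asks for integrable functions. The duality is used twice, in [inner] to reach the Poisson kernel
   and in [key] to move the transform off [h]. *)
have iem n : cintegrable (fun x => (e n x)%:C%C * m a b x).
  exact: (cintegrableMb (ie n) mm mM).
have inner n y : cintegral (fun x => cexpi (- (y * x)) * ((e n x)%:C%C * m a b x))
    = (step a b n y)%:C%C.
  rewrite (eq_cintegral (g := fun x => (cexpi (- (y * x)) * (e n x)%:C%C) *
     cintegral (fun z => cexpi (x * z) * (\1_`[a, b]%classic z)%:C%C))); last first.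
    by move=> x; rewrite mulrA.
  rewrite (kernel_duality (k := fun p => cexpi (p.1 * p.2))).
  - rewrite (eq_cintegral (g := fun z => (\1_`[a, b]%classic z *
      (2 * n.+1%:R^-1 / (n.+1%:R^-1 ^+ 2 + (z - y) ^+ 2)))%:C%C)); last first.
      move=> z; rewrite rmorphM/= -poisson_kernel//; congr (_ * _).
      apply: eq_cintegral => x; rewrite mulrA -cexpiD; congr (cexpi _ * _).
      by rewrite mulrBl mulrC.
    by rewrite cintegralR poisson_itv.
  - exact: cmeasurable_cexpi_prod.
  - by move=> p; rewrite normc_cexpi.
  - apply: cintegrable_cexpi_mul => //; apply: measurable_funN.
    exact: mulrl_measurable.
  - exact: ii.
have key n : cintegral (fun x => F h x * m a b x * (e n x)%:C%C) =
    cintegral (fun y => h y * (step a b n y)%:C%C).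
  rewrite (eq_cintegral (g := fun x => ((e n x)%:C%C * m a b x) *
     cintegral (fun y => cexpi (- (y * x)) * h y))); last first.
    by move=> x; rewrite mulrC mulrA mulrAC.
  rewrite (kernel_duality (k := fun p => cexpi (- (p.2 * p.1)))) //.
  - by apply: eq_cintegral => y; rewrite inner.
  - exact: cmeasurable_cexpi_prodN.
  - by move=> p; rewrite normc_cexpi.
have cve : \forall x \ae leb, e n x @[n --> \oo] --> cst (1 : R) x.
  apply: (aeW leb) => x.
  have cx : - (n.+1%:R^-1 * `|x|) @[n --> \oo] --> - (0 * `|x|).
    by apply: cvgN; apply: cvgM; [exact: cvg_harmonic|exact: cvg_cst].
  have := cvg_comp _ expR cx (@continuous_expR R _).
  by rewrite mul0r oppr0 expR0.
have [c1 c2] := cintegral_dominated iFm (fun n => measurable_expN_abs _)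
  (measurable_cst _) e1 cve.
have cvs : \forall y \ae leb,
    step a b n y @[n --> \oo] --> 2 * pi * \1_`[a, b]%classic y.
  apply: (@negligibleS _ _ _ leb [set a; b]); last first.
    exists [set a; b]; split; [exact: measurableU| |by []].
    by apply: countable_lebesgue_measure0; exact: finite_set_countable.
  move=> y /= nc; apply: contrapT => /not_orP[ya yb]; apply: nc.
  by apply: cvg_step => //; exact/eqP.
have mi : measurable_fun setT
    ((fun y => 2 * pi * \1_`[a, b]%classic y) : mR -> R).
  by apply: measurable_funM; [exact: measurable_cst|exact: measurable_indic].
have [d1 d2] := cintegral_dominated ih (measurable_step a b) mi
  (step_le a b) cvs.
have hR := @Rhausdorff R.
have <- : cintegral (fun x => F h x * m a b x * (cst (1 : R) x)%:C%C) =
    cintegral (fun x => F h x * m a b x).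
  by apply: eq_cintegral => x; rewrite mulr1.
rewrite -cintegralZl; last first.
  apply: (@cintegrableMb _ _ _ 1) => //; first exact: cintegrable_cmeas ii.
  by move=> y; rewrite normcR indicE ger0_norm// lern1 leq_b1.
rewrite [RHS](eq_cintegral (g := fun y =>
    h y * (2 * pi * \1_`[a, b]%classic y)%:C%C)); last first.
  by move=> y; rewrite mulrCA -rmorphM.
apply: eq_complexP.
- rewrite -(cvg_lim hR d1); apply/esym/(cvg_lim hR); apply: cvg_trans c1.
  by apply: near_eq_cvg; apply: nearW => n; rewrite key.
- rewrite -(cvg_lim hR d2); apply/esym/(cvg_lim hR); apply: cvg_trans c2.
  by apply: near_eq_cvg; apply: nearW => n; rewrite key.
Qed.

End WeakInversion.

(** * Schwartz functions *)

Section RapidDecay.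
Context {R : realType}.
Local Notation mR := (measurableTypeR R).
Local Notation w := (fun x : R => (1 + x ^+ 2)^-1).
Implicit Types (u : R -> R) (phi : R -> R[i]).

(** Real-valued Schwartz functions: differentiation is real, so complex test functions are handled
    through their two components. *)
Definition rapid u : Prop :=
  (forall n x, derivable (derive1n n u) x 1) /\
  forall m n, exists M, forall x, `|x| ^+ m * `|derive1n n u x| <= M.

Lemma schwartz_seminorm_ub phi (m n : nat) x :
  ((`|x| ^+ m * normc (cderiv n phi x))%:E <= schwartz_seminorm m n phi)%E.
Proof. by apply: ereal_sup_ubound; exists x. Qed.

Lemma schwartz_seminorm_fin phi m n : schwartz phi ->
  schwartz_seminorm m n phi \is a fin_num.
Proof.
move=> [_ /(_ m n) sl]; rewrite ge0_fin_numE//.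
apply: le_trans (schwartz_seminorm_ub phi m n 0).
by rewrite lee_fin mulr_ge0 ?normc_ge0 ?exprn_ge0.
Qed.

Lemma schwartz_rapid phi : schwartz phi ->
  rapid (fun x => Re (phi x)) /\ rapid (fun x => Im (phi x)).
Proof.
move=> sp; have [sm _] := sp; split; (split; first by move=> n x; case: (sm n x));
  move=> m n; exists (fine (schwartz_seminorm m n phi)) => x;
  rewrite -lee_fin fineK ?schwartz_seminorm_fin//;
  apply: le_trans (schwartz_seminorm_ub phi m n x); rewrite lee_fin ler_wpM2l//.
- exact: (Re_le_normc (cderiv n phi x)).
- exact: (Im_le_normc (cderiv n phi x)).
Qed.

Lemma rapid_schwartz phi :
  rapid (fun x => Re (phi x)) -> rapid (fun x => Im (phi x)) -> schwartz phi.
Proof.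
move=> [d1 b1] [d2 b2]; split; first by move=> n x.
move=> m n; have [M1 h1] := b1 m n; have [M2 h2] := b2 m n.
apply: (@le_lt_trans _ _ (M1 + M2)%:E); last by rewrite ltry.
apply: ge_ereal_sup => _ [x _ <-]; rewrite lee_fin.
apply: (le_trans _ (lerD (h1 x) (h2 x))); rewrite -mulrDr ler_wpM2l//.
exact: (normc_le_ReIm (cderiv n phi x)).
Qed.

Lemma schwartz_decay phi x : schwartz phi ->
  normc (phi x) <= (fine (schwartz_seminorm 0 0 phi) +
                    fine (schwartz_seminorm 2 0 phi)) * w x.
Proof.
move=> sp; have fin m n := schwartz_seminorm_fin m n sp.
have h m : `|x| ^+ m * normc (phi x) <= fine (schwartz_seminorm m 0 phi).
  rewrite -lee_fin fineK//; apply: le_trans (schwartz_seminorm_ub phi m 0 x).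
  by rewrite lee_fin /cderiv /=; case: (phi x).
rewrite ler_pdivlMr ?ltr_wpDr ?sqr_ge0//.
have := lerD (h 0%N) (h 2%N); rewrite expr0 real_normK ?num_real//.
by apply: le_trans; rewrite -mulrDl mulrC.
Qed.

Lemma schwartz_integrable phi : schwartz phi -> cintegrable phi.
Proof.
move=> sp.
apply: (@cintegrable_dom _ _ (fun x => (fine (schwartz_seminorm 0 0 phi) +
                    fine (schwartz_seminorm 2 0 phi)) * w x)).
- have [[d1 _] [d2 _]] := schwartz_rapid sp.
  by split; apply: continuous_measurable_fun => x;
    apply/differentiable_continuous/derivable1_diffP; [exact: (d1 0%N)|exact: (d2 0%N)].
- exact/integrable_scale/integrable_oneDsqrV.
- by move=> x; exact: schwartz_decay.
Qed.

Lemma rapid_decay u n : rapid u ->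
  exists K, 0 <= K /\ forall x, `|derive1n n u x| <= K * w x.
Proof.
move=> [_ b]; have [M0 h0] := b 0%N n; have [M2 h2] := b 2%N n.
exists (M0 + M2); split=> [|x].
  by apply: addr_ge0; [apply: le_trans (h0 0)|apply: le_trans (h2 0)];
    rewrite mulr_ge0// exprn_ge0.
rewrite ler_pdivlMr ?ltr_wpDr ?sqr_ge0//.
have := lerD (h0 x) (h2 x); rewrite expr0 real_normK ?num_real//.
by apply: le_trans; rewrite -mulrDl mulrC.
Qed.

Lemma rapid_is_derive u n (x : R) : rapid u ->
  is_derive x 1 (derive1n n u) (derive1n n.+1 u x).
Proof.
by move=> [d _]; apply: DeriveDef; [exact: d|rewrite derive1nS derive1E].
Qed.

Lemma rapid_continuous u n : rapid u -> continuous (derive1n n u).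
Proof. by move=> ru; apply: continuousP_derive => y; exact: rapid_is_derive. Qed.

Lemma rapid_integrable u n (g : R -> R) (M : R) : rapid u ->
  continuous g -> (forall x, `|g x| <= M) ->
  leb.-integrable setT (EFin \o (fun x => derive1n n u x * g x)).
Proof.
move=> ru cg gM; have [K [K0 uK]] := rapid_decay n ru.
apply: (integrable_dom _ (integrable_scale (K * M) integrable_oneDsqrV)).
  by apply: continuous_measurable_fun => x; apply: cvgM;
    [exact: rapid_continuous|exact: cg].
by move=> x; rewrite normrM mulrAC ler_pM.
Qed.

Lemma continuous_cosM c : continuous (fun x : R => cos (c * x)).
Proof. by apply: continuousP_derive => y. Qed.

Lemma continuous_sinM c : continuous (fun x : R => sin (c * x)).
Proof. by apply: continuousP_derive => y. Qed.

(* [(u' cos(cx) + c u sin(cx))' = (u'' + c^2 u) cos(cx)], and likewise for the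
   sine, so that [c^2] times the transform of [u] is minus that of [u'']. *)
Lemma rapid_trig_decay u : rapid u ->
  exists K, forall c,
    `|\int[leb]_x (u x * cos (c * x))| <= K * w c /\
    `|\int[leb]_x (u x * sin (c * x))| <= K * w c.
Proof.
move=> ru.
have [K0 [K00 u0]] := rapid_decay 0 ru; have [K1 [K10 u1]] := rapid_decay 1 ru.
have [K2 [K20 u2]] := rapid_decay 2 ru.
pose W := \int[leb]_x w x.
have iw := @integrable_oneDsqrV R.
(* [K0 * W] bounds the transform of [u] and [K2 * W] that of [u'']; their sum bounds [1 + c^2] times
   the former. *)
exists (K0 * W + K2 * W) => c.
have du n (x : R) : is_derive x 1 (derive1n n u) (derive1n n.+1 u x).
  exact: rapid_is_derive.
have du0 (x : R) : is_derive x 1 u (derive1n 1 u x) by exact: (du 0%N).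
have cu : continuous u := @rapid_continuous u 0 ru.
have cosM1 x : `|cos (c * x)| <= 1 by exact: cos_max.
have sinM1 x : `|sin (c * x)| <= 1 by exact: sin_max.
have cc := @continuous_cosM c; have cs := @continuous_sinM c.
have bound (f g : R -> R) (K : R) : (forall x, `|f x| <= K * w x) ->
    (forall x, `|g x| <= 1) -> leb.-integrable setT (EFin \o (fun x => f x * g x)) ->
    `|\int[leb]_x (f x * g x)| <= K * W.
  move=> fK g1 ifg; apply: (le_trans (le_normr_Rintegral _ ifg)) => //.
  rewrite /W -RintegralZl//; apply: le_Rintegral => //.
  - exact: (integrable_norm ifg).
  - exact: integrable_scale.
  - by move=> x _; rewrite normrM -[leRHS]mulr1 ler_pM.
have w0 x : 0 <= w x by rewrite invr_ge0 addr_ge0 ?sqr_ge0.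
have gen (g : R -> R) :
    (forall x, `|g x| <= 1) -> continuous g ->
    \int[leb]_x (derive1n 2 u x * g x + c ^+ 2 * (u x * g x)) = 0 ->
    `|\int[leb]_x (u x * g x)| <= (K0 * W + K2 * W) * w c.
  move=> g1 cg.
  have i0 := rapid_integrable 0 ru cg g1; have i2 := rapid_integrable 2 ru cg g1.
  rewrite RintegralD ?RintegralZl//; last exact: integrable_scale.
  have := bound _ _ _ u0 g1 i0; have := bound _ _ _ u2 g1 i2.
  rewrite /= -/(derive1n 2 u).
  set I2 := \int[leb]_x (derive1n 2 u x * g x); set I0 := \int[leb]_x (u x * g x).
  move=> h2 h0 e; rewrite ler_pdivlMr ?ltr_wpDr ?sqr_ge0//.
  have -> : `|I0| * (1 + c ^+ 2) = `|I0 + c ^+ 2 * I0|.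
    by rewrite -{2}[I0]mul1r -mulrDl normrM mulrC [`|1 + _|]ger0_norm ?addr_ge0 ?sqr_ge0.
  have -> : c ^+ 2 * I0 = - I2 by apply/eqP; rewrite -addr_eq0 addrC e.
  by apply: le_trans (ler_normB _ _) _; exact: lerD.
split; apply: gen => //.
- apply: (@Rintegral_derive0 _ _ (fun x => derive1n 1 u x * cos (c * x) +
    c * (u x * sin (c * x))) (K1 + `|c| * K0)).
  + exact: (integrableD measurableT (rapid_integrable 2 ru cc cosM1)
      (integrable_scale (c ^+ 2) (rapid_integrable 0 ru cc cosM1))).
  + by move=> x; apply: is_derive_eq; rewrite /GRing.scale/=; ring.
  + move=> x; apply: cvgD; first by apply: cvgM;
      [exact: rapid_continuous|exact: cc].
    apply: cvgM; first exact: cvg_cst.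
    by apply: cvgM; [exact: cu|exact: cc].
  + move=> x; apply: le_trans (ler_normD _ _) _; rewrite mulrDl !normrM.
    apply: lerD; first by rewrite -[leRHS]mulr1 ler_pM.
    rewrite -mulrA ler_wpM2l// -[leRHS]mulr1 ler_pM//; exact: u0.
- apply: (@Rintegral_derive0 _ _ (fun x => derive1n 1 u x * sin (c * x) -
    c * (u x * cos (c * x))) (K1 + `|c| * K0)).
  + exact: (integrableD measurableT (rapid_integrable 2 ru cs sinM1)
      (integrable_scale (c ^+ 2) (rapid_integrable 0 ru cs sinM1))).
  + by move=> x; apply: is_derive_eq; rewrite /GRing.scale/=; ring.
  + move=> x; apply: cvgD; first by apply: cvgM;
      [exact: rapid_continuous|exact: cs].
    apply: cvgM; first exact: cvg_cst.
    by apply: cvgM; [exact: cu|exact: cs].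
  + move=> x; apply: le_trans (ler_normB _ _) _; rewrite mulrDl !normrM.
    apply: lerD; first by rewrite -[leRHS]mulr1 ler_pM.
    rewrite -mulrA ler_wpM2l// -[leRHS]mulr1 ler_pM//; exact: u0.
Qed.

End RapidDecay.

Section FourierSchwartz.
Context {R : realType}.
Local Notation mR := (measurableTypeR R).
Implicit Types (phi : R -> R[i]).

(** The hypothesis of [weak_inversion] for Schwartz functions. Each component of the transform is a
    sum or difference of a cosine and a sine transform of [Re phi] and [Im phi], all of order
    [1 / (1 + c^2)]. *)
Lemma schwartz_fourier_ker_integrable phi : schwartz phi ->
  cintegrable (fun c => cintegral (fun x => cexpi (- (x * c)) * phi x)).
Proof.
move=> sp; have ip := schwartz_integrable sp.
have [/rapid_trig_decay[K hK] /rapid_trig_decay[L hL]] := schwartz_rapid sp.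
apply: (cintegrable_dom _ (integrable_scale ((K + L) + (K + L)) integrable_oneDsqrV)).
  exact: (cmeasurable_fourier_ker (cintegrable_cmeas ip)).
have [ip1 ip2] := ip.
have it (u : R -> R) (g : R -> R) : leb.-integrable setT (EFin \o u) ->
    continuous g -> (forall x, `|g x| <= 1) ->
    leb.-integrable setT (EFin \o (fun x => u x * g x)).
  move=> iu cg g1; apply: (integrable_dom _ (integrable_norm iu)).
    apply: measurable_funM; last exact: continuous_measurable_fun.
    by apply/measurable_EFinP; exact: measurable_int iu.
  by move=> x /=; rewrite normrM -[leRHS]mulr1 ler_pM.
move=> c; apply: (le_trans (normc_le_ReIm _)) => /=.
have c1 := @continuous_cosM R c; have s1 := @continuous_sinM R c.
have cm x : `|cos (c * x)| <= 1 by exact: cos_max.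
have sm x : `|sin (c * x)| <= 1 by exact: sin_max.
have [h1 h2] := hK c; have [h3 h4] := hL c.
have -> : \int[leb]_x Re (cexpi (- (x * c)) * phi x) =
    \int[leb]_x (Re (phi x) * cos (c * x)) + \int[leb]_x (Im (phi x) * sin (c * x)).
  rewrite -RintegralD//; do ?exact: it.
  by apply: eq_Rintegral => x _; rewrite cReM/= cosN sinN mulrC [x * c]mulrC; ring.
have -> : \int[leb]_x Im (cexpi (- (x * c)) * phi x) =
    \int[leb]_x (Im (phi x) * cos (c * x)) - \int[leb]_x (Re (phi x) * sin (c * x)).
  rewrite -RintegralB//; do ?exact: it.
  by apply: eq_Rintegral => x _; rewrite cImM/= cosN sinN mulrC [x * c]mulrC; ring.
rewrite mulrDl; apply: lerD.
- by apply: le_trans (ler_normD _ _) _; rewrite mulrDl lerD.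
- by apply: le_trans (ler_normB _ _) _; rewrite mulrDl addrC lerD.
Qed.

End FourierSchwartz.

Section GaussianTestFunctions.
Context {R : realType}.
Local Notation mR := (measurableTypeR R).
Implicit Types (p q : {poly R}) (c x : R).

Lemma poly_gauss_bounded p :
  forall k, exists M, forall x, `|x| ^+ k * `|p.[x]| * expR (- x ^+ 2) <= M.
Proof.
have mono k : exists M, forall x : R, `|x| ^+ k * expR (- x ^+ 2) <= M.
  (* For positive [k], this combines [|x|^k <= 1 + x^(2k)] with [exp (x^2) >= 1 + x^(2k) / k!]. *)
  exists (1 + k`!%:R) => x.
  rewrite expRN ler_pdivrMr ?expR_gt0//.
  case: k => [|k].
    rewrite expr0 fact0; have : 1 <= expR (x ^+ 2) by rewrite -expR0 ler_expR sqr_ge0.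
    by move: (expR _) => y; lra.
  have x20 : 0 <= x ^+ 2 by exact: sqr_ge0.
  have h := expR_ge1Dxn k x20; have f0 : 0 < (k.+1)`!%:R :> R by rewrite ltr0n fact_gt0.
  rewrite -(real_normK (num_real x)) in h x20 *; set y := `|x| in h x20 *.
  have y0 : 0 <= y by exact: normr_ge0.
  have hy : y ^+ k.+1 <= 1 + (y ^+ 2) ^+ k.+1.
    have [y1|y1] := leP y 1.
      by rewrite (le_trans (exprn_ile1 _ y0 y1))// lerDl exprn_ge0.
    rewrite -exprM ler_wpDl// ler_eXn2l//.
    by rewrite mulnC leq_pmulr.
  apply: (le_trans hy); move: h f0; set E := expR _; set F := (_`!%:R) => h F0.
  have {}h : F + (y ^+ 2) ^+ k.+1 <= F * E.
    apply: le_trans (ler_wpM2l (ltW F0) h).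
    by rewrite mulrDr mulr1 lerD2l mulrCA divff ?gt_eqF// mulr1.
  have E1 : 1 <= E by rewrite -expR0 ler_expR.
  by rewrite mulrDl mul1r lerD//; apply: le_trans h; rewrite lerDr ltW.
(* The bound is quantified over [k] so that a factor ['X] can be absorbed into [|x|^(k + 1)]. *)
elim/poly_ind: p => [k|p a IH k].
  by exists 0 => x; rewrite horner0 normr0 mulr0 mul0r.
have [M1 h1] := IH k.+1; have [M2 h2] := mono k.
exists (M1 + `|a| * M2) => x; rewrite hornerMXaddC.
apply: (@le_trans _ _ (`|x| ^+ k.+1 * `|p.[x]| * expR (- x ^+ 2) +
    `|a| * (`|x| ^+ k * expR (- x ^+ 2)))); last first.
  by apply: lerD; [exact: h1|rewrite ler_wpM2l].
rewrite [`|a| * _]mulrA [`|a| * _]mulrC -mulrDl ler_wpM2r ?expR_ge0//.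
rewrite exprSr -mulrA -mulrDr ler_wpM2l ?exprn_ge0//.
by apply: le_trans (ler_normD _ _) _; rewrite normrM mulrC.
Qed.

(** For fixed [c] these functions form a class closed under differentiation ([dgt]) that contains
    both components of the modulated Gaussian. Every seminorm bound thus reduces to
    [poly_gauss_bounded]. *)
Let gt c p q x : R := expR (- x ^+ 2) * (p.[x] * cos (c * x) + q.[x] * sin (c * x)).

Let dgt c p q (x : R) : is_derive x 1 (gt c p q)
  (gt c (p^`() - 2%:P * 'X * p + c%:P * q)%R (q^`() - 2%:P * 'X * q - c%:P * p)%R x).
Proof.
have de : is_derive x 1 (fun y : R => expR (- y ^+ 2)) (- (2 * x) * expR (- x ^+ 2)).
  have d2 : is_derive x 1 (fun y : R => - y ^+ 2) (- (2 * x)).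
    by apply: is_derive_eq; rewrite /GRing.scale/= mulr1; ring.
  by rewrite mulrC; exact: (is_derive1_comp (is_derive_expR _) d2).
apply: is_derive_eq; rewrite /gt !hornerE /GRing.scale/=; ring.
Qed.

Let gt_derive1n c p q n : exists p' q', derive1n n (gt c p q) = gt c p' q'.
Proof.
elim: n p q => [|n IH] p q; first by exists p, q.
rewrite derive1Sn.
have -> : (gt c p q)^`()%classic = gt c (p^`() - 2%:P * 'X * p + c%:P * q)%R
    (q^`() - 2%:P * 'X * q - c%:P * p)%R.
  by apply/funext => x; rewrite derive1E; have [_ ->] := dgt c p q x.
exact: IH.
Qed.

Let gt_rapid c p q : rapid (gt c p q).
Proof.
split=> [n x|m n].
  by have [p' [q' ->]] := gt_derive1n c p q n; have [] := dgt c p' q' x.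
have [p' [q' ->]] := gt_derive1n c p q n.
have [M1 h1] := poly_gauss_bounded p' m; have [M2 h2] := poly_gauss_bounded q' m.
exists (M1 + M2) => x; rewrite /gt normrM ger0_norm ?expR_ge0//.
apply: le_trans (lerD (h1 x) (h2 x)).
rewrite [expR _ * _]mulrC -mulrDl mulrA ler_wpM2r ?expR_ge0//.
rewrite -mulrDr ler_wpM2l ?exprn_ge0//.
apply: le_trans (ler_normD _ _) _; rewrite !normrM lerD//.
- by rewrite ler_piMr// cos_max.
- by rewrite ler_piMr// sin_max.
Qed.

Lemma schwartz_gauss c :
  schwartz (fun x => cexpi (- (x * c)) * (expR (- x ^+ 2))%:C%C).
Proof.
apply: rapid_schwartz.
- have := gt_rapid (- c) 1 0; congr rapid; apply/funext => x.
  by rewrite /gt !hornerE cReM/= mulr0 subr0 mulrC mulNr [x * c]mulrC; ring.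
- have := gt_rapid (- c) 0 1; congr rapid; apply/funext => x.
  by rewrite /gt !hornerE cImM/= mulr0 add0r mulrC mulNr [x * c]mulrC; ring.
Qed.

End GaussianTestFunctions.

(** * Functions representing the same distribution agree almost everywhere *)

Section Uniqueness.
Context {R : realType}.
Local Notation mR := (measurableTypeR R).

(** The primitive of [f] from minus infinity has zero increments, so it is constant; by Lebesgue
    differentiation its derivative is [f] almost everywhere. *)
Lemma integral_itv0_ae0 (f : R -> R) : leb.-integrable setT (EFin \o f) ->
  (forall a b, a < b -> \int[leb]_x (f x * \1_`[a, b]%classic x) = 0) ->
  \forall x \ae leb, f x = 0.
Proof.
move=> intf f0.
have inti (i : interval R) : leb.-integrable [set` i] (EFin \o f).
  exact: integrableS intf.
have lf := integrable_locally measurableT intf; rewrite patch_setT in lf.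
have := FTC1Ny (fun y => inti _) lf.
apply: (@filterS _ _ (ae_filter_ringOfSetsType leb)) => x [_ <-].
have Fxy (y z : R) : y < z ->
    \int[leb]_(t in `]-oo, z]) f t = \int[leb]_(t in `]-oo, y]) f t.
  move=> yz; apply/eqP; rewrite -subr_eq0 Rintegral_itvB ?bnd_simp ?(ltW yz)//.
  by rewrite Rintegral_itv_obnd_cbnd// Rintegral_indic_mul f0.
rewrite [X in X^`()%classic](_ : _ = cst (\int[leb]_(t in `]-oo, x]) f t)).
  by rewrite derive1_cst.
apply/funext => y; rewrite /cst; case: (ltgtP y x) => [|/Fxy->|->]// yx.
by rewrite -(Fxy _ _ yx).
Qed.

Lemma cintegral_itv0_ae0 (h : R -> R[i]) : cintegrable h ->
  (forall a b, a < b -> cintegral (fun y => h y * (\1_`[a, b]%classic y)%:C%C) = 0) ->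
  \forall x \ae leb, h x = 0.
Proof.
move=> [h1 h2] h0.
have E1 a b : a < b -> \int[leb]_y (Re (h y) * \1_`[a, b]%classic y) = 0.
  move=> ab; transitivity (Re (cintegral (fun y =>
    h y * (\1_`[a, b]%classic y)%:C%C))); last by rewrite h0.
  by apply: eq_Rintegral => y _; rewrite cReM/= mulr0 subr0.
have E2 a b : a < b -> \int[leb]_y (Im (h y) * \1_`[a, b]%classic y) = 0.
  move=> ab; transitivity (Im (cintegral (fun y =>
    h y * (\1_`[a, b]%classic y)%:C%C))); last by rewrite h0.
  by apply: eq_Rintegral => y _; rewrite cImM/= mulr0 add0r.
have F := ae_filter_ringOfSetsType (@lebesgue_measure R).
apply: (filterS2 _ _ (integral_itv0_ae0 h1 E1) (integral_itv0_ae0 h2 E2)).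
by move=> x e1 e2; apply: eq_complexP.
Qed.

(* Testing against [exp (- x^2) e^(- i x c)] for all [c] shows that the
   integrable function [(g1 - g2) exp (- x^2)] has zero Fourier transform. *)
Lemma represents_ae_unique (g1 g2 : R -> R[i]) (T : distr R) :
  represents g1 T -> represents g2 T -> \forall x \ae leb, g1 x = g2 x.
Proof.
move=> [m1 r1] [m2 r2].
pose h x := (g1 x - g2 x) * (expR (- x ^+ 2))%:C%C.
have mh : cmeas h.
  apply: cmeasurableM; first exact: cmeasurableB.
  apply: cmeasurableR; apply: continuous_measurable_fun.
  exact: continuous_gauss_fun.
have zero c : cintegrable (fun y => cexpi (- (y * c)) * h y) /\
    cintegral (fun y => cexpi (- (y * c)) * h y) = 0.
  have sc := schwartz_gauss c.
  have [i1 t1] := r1 _ sc; have [i2 t2] := r2 _ sc.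
  set psi := (fun x : R => cexpi (- (x * c)) * _) in sc i1 i2 t1 t2.
  have E y : cexpi (- (y * c)) * h y = g1 y * psi y + (-1) * (g2 y * psi y).
    by rewrite /h /psi; ring.
  have in2 := cintegrableZl (-1) i2.
  rewrite (funext E); split; first exact: cintegrableD.
  rewrite cintegralD// cintegralZl// -/(distr_of_fun g1 psi) -/(distr_of_fun g2 psi).
  by rewrite -t1 -t2 mulN1r subrr.
(* At [c = 0] the test function is the Gaussian itself, and pairing with it includes
   integrability. *)
have ih : cintegrable h.
  have [+ _] := zero 0; congr cintegrable; apply/funext => y.
  by rewrite mulr0 oppr0 cexpi0 mul1r.
have z0 c : cintegral (fun y => cexpi (- (y * c)) * h y) = 0 by have [] := zero c.
(* The transform of [h] is identically 0, hence integrable, and [weak_inversion] equates 0 with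
   [2 * pi] times the integral of [h] over [[a, b]]. *)
have h0 a b : a < b -> cintegral (fun y => h y * (\1_`[a, b]%classic y)%:C%C) = 0.
  move=> ab; have i0 : cintegrable (fun c => cintegral (fun y => cexpi (- (y * c)) * h y)).
    by rewrite (funext z0); split; exact: integrable0.
  have := weak_inversion ab ih i0.
  rewrite (eq_cintegral (g := fun _ => 0%:C%C)); last first.
    by move=> x; rewrite z0 mul0r.
  rewrite cintegralR Rintegral_cst// mul0r => /esym/eqP; rewrite mulf_eq0.
  case/orP => [|/eqP//]; rewrite eq_complex/= => /andP[/eqP p0 _].
  by exfalso; have := @pi_gt0 R; lra.
have := cintegral_itv0_ae0 ih h0.
apply: (@filterS _ _ (ae_filter_ringOfSetsType leb)) => x /eqP.
rewrite mulf_eq0 subr_eq0 => /orP[/eqP//|].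
by rewrite eq_complex/= gt_eqF ?expR_gt0.
Qed.

End Uniqueness.

(** * Tempered distributions and the Ostrovsky flow *)

Section TemperedDistributions.
Context {R : realType}.
Local Notation mR := (measurableTypeR R).
Implicit Types (f g phi : R -> R[i]).

Let lee_sum33 (P : nat -> nat -> \bar R) :
  (forall m n, 0 <= P m n)%E ->
  (P 0%N 0%N + P 2%N 0%N <= \sum_(m < 3) \sum_(n < 3) P m n)%E.
Proof.
move=> p0; rewrite !big_ord_recl !big_ord0 /= !adde0.
apply: leeD; first by rewrite leeDl// adde_ge0.
by apply: lee_paddl; rewrite ?adde_ge0// leeDl// adde_ge0.
Qed.

Lemma bounded_tempered f (B : R) : cmeas f -> (forall x, normc (f x) <= B) ->
  tempered (distr_of_fun f).
Proof.
move=> mf fB.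
have ifp phi : schwartz phi -> cintegrable (fun x => f x * phi x).
  move=> /schwartz_integrable ip; under eq_fun do rewrite mulrC.
  exact: cintegrableMb ip mf fB.
have B0 : 0 <= B := le_trans (normc_ge0 (f 0)) (fB 0).
pose W := \int[leb]_x (1 + x ^+ 2 : R)^-1.
have W0 : 0 <= W.
  by apply: Rintegral_ge0 => x _; rewrite invr_ge0 addr_ge0 ?sqr_ge0.
split=> [a phi psi sp sq|].
  rewrite /distr_of_fun -cintegralZl; last exact: ifp.
  rewrite -cintegralD; [|by apply: cintegrableZl; exact: ifp|exact: ifp].
  by apply: eq_cintegral => x; ring.
(* Order 2 because [schwartz_decay] calls on the seminorms [(0, 0)] and [(2, 0)]; the leading 2 is
   that of [normc_cintegral_le]. *)
exists 2%N, (2 * (B * W)) => phi sp.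
pose S := (fine (schwartz_seminorm 0 0 phi) + fine (schwartz_seminorm 2 0 phi))%R.
have le1 : normc (distr_of_fun f phi) <= 2 * (B * W) * S.
  have -> : 2 * (B * W) * S = 2 * \int[leb]_x (B * S * (1 + x ^+ 2)^-1).
    by rewrite RintegralZl//; [rewrite -/W; ring|exact: integrable_oneDsqrV].
  apply: normc_cintegral_le; first exact: ifp.
    exact/integrable_scale/integrable_oneDsqrV.
  move=> x; rewrite Normc.normcM -mulrA ler_pM ?normc_ge0//.
  exact: schwartz_decay.
have p0 m n : (0 <= schwartz_seminorm m n phi)%E.
  apply: le_trans (schwartz_seminorm_ub phi m n 0).
  by rewrite lee_fin mulr_ge0 ?normc_ge0 ?exprn_ge0.
apply: (@le_trans _ _ ((2 * (B * W))%:E * S%:E)%E); first by rewrite -EFinM lee_fin.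
apply: lee_wpmul2l; first by rewrite lee_fin !mulr_ge0.
rewrite EFinD !fineK ?schwartz_seminorm_fin//.
exact: (lee_sum33 (P := fun m n => schwartz_seminorm m n phi)).
Qed.

Lemma integrable_ae_eq (u v : R -> R) :
  measurable_fun setT (u : mR -> R) -> leb.-integrable setT (EFin \o v) ->
  (\forall x \ae leb, u x = v x) -> leb.-integrable setT (EFin \o u).
Proof.
move=> mu /integrableP[mv iv] uv; apply/integrableP.
split; first exact/measurable_EFinP.
apply: le_lt_trans iv; rewrite le_eqVlt; apply/orP; left; apply/eqP.
apply: ae_eq_integral => //.
- by apply: measurableT_comp => //; exact/measurable_EFinP.
- exact: measurableT_comp.
- by apply: (@filterS _ _ (ae_filter_ringOfSetsType leb)) uv => x /= ->.
Qed.

Lemma cintegrable_ae_eq f g : cmeas f -> cintegrable g ->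
  (\forall x \ae leb, f x = g x) -> cintegrable f.
Proof.
move=> [f1 f2] [g1 g2] fg; split.
- apply: (integrable_ae_eq f1 g1).
  by apply: (@filterS _ _ (ae_filter_ringOfSetsType leb)) fg => x ->.
- apply: (integrable_ae_eq f2 g2).
  by apply: (@filterS _ _ (ae_filter_ringOfSetsType leb)) fg => x ->.
Qed.

Lemma fourier_fun_represents g (T : distr R) : represents g (distr_fourier T) ->
  represents (fourier_fun T) (distr_fourier T).
Proof. by move=> rg; rewrite /fourier_fun; case: xgetP => // /(_ g). Qed.

Lemma fourier_fun_ae g (T : distr R) : represents g (distr_fourier T) ->
  \forall x \ae leb, fourier_fun T x = g x.
Proof.
by move=> rg; exact: (represents_ae_unique (fourier_fun_represents rg) rg).
Qed.

End TemperedDistributions.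

Section OstrovskyFlow.
Context {R : realType}.
Local Notation mR := (measurableTypeR R).
Implicit Types (f g phi : R -> R[i]) (neg : bool) (t : R).

Lemma measurable_dispersion neg : measurable_fun setT (dispersion neg : mR -> R).
Proof.
have mV : measurable_fun setT (fun x : mR => (x : R)^-1).
  (* Inversion is discontinuous at 0, so it is written as [x (x^2)^-1], with a measurable power
     function. At 0 both sides are 0. *)
  rewrite (_ : (fun x : mR => _) = (fun x : mR => (x : R) * ((x : R) ^+ 2) `^ (-1))).
    apply: measurable_funM; first exact: measurable_id.
    by apply: (measurableT_comp (measurable_powR _)); exact: measurable_funX.
  apply/funext => x /=; rewrite powR_inv1 ?sqr_ge0//.
  have [->|x0] := eqVneq (x : R) 0; first by rewrite mul0r invr0.
  by rewrite expr2 invfM mulVKf.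
apply: measurable_funD; first exact: measurable_funX.
by apply: measurable_funM; [exact: measurable_cst|exact: mV].
Qed.

Lemma cmeasurable_evolution neg :
  cmeasurable (fun p : mR * mR => cexpi (p.1 * dispersion neg p.2)).
Proof.
apply: cmeasurable_cexpi; apply: measurable_funM; first exact: measurable_fst.
exact: (measurableT_comp (measurable_dispersion neg) measurable_snd).
Qed.

Lemma cintegrable_evolution neg t g : cintegrable g ->
  cintegrable (fun xi => cexpi (t * dispersion neg xi) * g xi).
Proof.
apply: cintegrable_cexpi_mul; apply: measurable_funM.
  exact: measurable_cst.
exact: measurable_dispersion.
Qed.

(** The chosen representative [fourier_fun T] equals [g] only almost everywhere, which the integral
    does not see; [U(t)] can then be computed from an explicit transform. *)
Lemma ostrovskyE neg t (T : distr R) g x : cintegrable g ->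
  represents g (distr_fourier T) ->
  ostrovsky neg t T x =
  inv_fourier (fun xi => cexpi (t * dispersion neg xi) * g xi) x.
Proof.
move=> ig rg; have ae := fourier_fun_ae rg.
have [mff _] := fourier_fun_represents rg.
rewrite /ostrovsky /inv_fourier /evolved_fourier; congr (_ * _).
have iff := cintegrable_ae_eq mff ig ae.
apply: ae_eq_cintegral.
- exact/cintegrable_cmeas/cintegrable_inv_fourier_ker/cintegrable_evolution.
- exact/cintegrable_cmeas/cintegrable_inv_fourier_ker/cintegrable_evolution.
- by apply: (@filterS _ _ (ae_filter_ringOfSetsType leb)) ae => xi /= ->.
Qed.

(** Refuting the maximal inequality requires an actual version of the flow. For an integrable
    transform the pointwise integral is one: it is jointly measurable, and Fubini moves the inverse
    transform from the test function to the evolved data. *)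
Lemma ostrovsky_versionP neg (T : distr R) : cintegrable (fourier_fun T) ->
  ostrovsky_version neg T (fun p => ostrovsky neg p.2 T p.1).
Proof.
move=> iff; have mff := cintegrable_cmeas iff.
have mF : @cmeasurable R _ (mR * mR)%type (fun p => ostrovsky neg p.2 T p.1).
  apply: cmeasurableM; first exact: cmeasurable_cst.
  (* Here [q] stands for [((x, t), xi)], and the variable [xi] is integrated out. *)
  apply: (cmeasurable_cintegral (k := fun q : (mR * mR) * mR =>
    cexpi (q.1.1 * q.2) * evolved_fourier neg q.1.2 T q.2)).
  apply: cmeasurableM.
    apply: (cmeasurable_comp (f := fun p : mR * mR => cexpi (p.1 * p.2))
      (g := fun q : (mR * mR) * mR => (q.1.1, q.2))); last exact: cmeasurable_cexpi_prod.
    apply: measurable_fun_pair; last exact: measurable_snd.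
    exact: (measurableT_comp measurable_fst measurable_fst).
  apply: cmeasurableM.
    apply: (cmeasurable_comp (f := fun p : mR * mR => cexpi (p.1 * dispersion neg p.2))
      (g := fun q : (mR * mR) * mR => (q.1.2, q.2))); last exact: cmeasurable_evolution.
    apply: measurable_fun_pair; last exact: measurable_snd.
    exact: (measurableT_comp measurable_snd measurable_fst).
  exact: (cmeasurable_comp measurable_snd mff).
split=> // t.
have iev := cintegrable_evolution neg t iff.
have mFt : cmeas (fun x => ostrovsky neg t T x).
  exact: (cmeasurable_comp (measurable_pair2 t) mF).
have Fb x : normc (ostrovsky neg t T x) <=
    normc ((Num.sqrt (2 * pi))^-1 : R)%:C%C *
    (2 * \int[leb]_y normc (evolved_fourier neg t T y)).
  rewrite /ostrovsky /inv_fourier Normc.normcM ler_wpM2l ?normc_ge0//.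
  exact: normc_inv_fourier_ker_le.
split=> // phi sp; have ip := schwartz_integrable sp; split.
  by under eq_fun do rewrite mulrC; exact: cintegrableMb ip mFt Fb.
rewrite /ostrovsky_distr /distr_inv_fourier /distr_of_fun /inv_fourier.
set c0 := (_%:C)%C.
rewrite (eq_cintegral (g := fun x => c0 * (evolved_fourier neg t T x *
    cintegral (fun y => cexpi (x * y) * phi y)))); last by move=> x; rewrite mulrCA.
have mc : cmeas (fun x => cintegral (fun y => cexpi (x * y) * phi y)).
  exact: (cmeasurable_inv_fourier_ker (cintegrable_cmeas ip)).
rewrite cintegralZl; last first.
  exact: (cintegrableMb iev mc (fun x => normc_inv_fourier_ker_le x ip)).
rewrite (kernel_duality (k := fun p => cexpi (p.1 * p.2)))//; last 2 first.
- exact: cmeasurable_cexpi_prod.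
- by move=> p; rewrite normc_cexpi.
have mc' : cmeas (fun y => cintegral (fun x => cexpi (y * x) * evolved_fourier neg t T x)).
  exact: (cmeasurable_inv_fourier_ker (cintegrable_cmeas iev)).
have E y : phi y * cintegral (fun x => cexpi (x * y) * evolved_fourier neg t T x)
  = phi y * cintegral (fun x => cexpi (y * x) * evolved_fourier neg t T x).
  by congr (_ * _); apply: eq_cintegral => x; rewrite mulrC [x * y]mulrC mulrC.
rewrite (eq_cintegral E) -cintegralZl; last first.
  exact: (cintegrableMb ip mc' (fun x => normc_inv_fourier_ker_le x iev)).
by apply: eq_cintegral => y; rewrite /ostrovsky /inv_fourier -/c0 mulrCA mulrC.
Qed.

End OstrovskyFlow.

(** * The dyadic example *)

Section NormBounds.
Context {R : realType}.
Local Notation mR := (measurableTypeR R).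

Lemma integrable_indic_fin (A : set R) (m : R) :
  measurable (A : set mR) -> leb A = m%:E ->
  leb.-integrable setT (EFin \o (\1_A : R -> R)).
Proof.
move=> mA Am; apply/integrableP; split.
  by apply/measurable_EFinP; exact: measurable_indic.
apply: (@le_lt_trans _ _ (\int[leb]_x (\1_A x)%:E)%E).
  by apply: ge0_le_integralT => // x; rewrite /= lee_fin ger0_norm// indicE.
have Aoo : (leb A < +oo)%E by rewrite Am ltry.
by rewrite integral_indic// setIT.
Qed.

(** Chebyshev's bound, obtained through [ge0_le_integralT] because [f] will be [maximal_fun], a
    supremum over uncountably many times. *)
Lemma Lnorm_ge (p v m : R) (A : set R) (f : R -> \bar R) :
  0 < p -> 0 <= v -> 0 <= m -> measurable (A : set mR) -> leb A = m%:E ->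
  (forall x, A x -> (v%:E <= `|f x|)%E) ->
  ((v * m `^ p^-1)%:E <= 'N[leb]_(p%:E) [f])%E.
Proof.
move=> p0 v0 m0 mA Am fA; rewrite unlock.
have -> : v * m `^ p^-1 = (v `^ p * m) `^ p^-1.
  by rewrite powRM ?powR_ge0// -powRrM divff ?gt_eqF// powRr1.
rewrite -poweR_EFin; apply: gt0_ler_poweR; rewrite ?invr_ge0 ?(ltW p0)//.
- by rewrite in_itv/= lee_fin leey mulr_ge0// powR_ge0.
- by rewrite in_itv/= leey andbT; apply: integral_ge0 => x _; exact: poweR_ge0.
have mE : m%:E = (\int[leb]_x (\1_A x)%:E)%E by rewrite integral_indic// setIT.
rewrite EFinM mE -integralZl//; last exact: integrable_indic_fin Am.
apply: ge0_le_integralT => x.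
  by rewrite -EFinM lee_fin mulr_ge0 ?powR_ge0.
rewrite -EFinM indicE; case: (boolP (x \in A)) => [/set_mem xA|_].
  rewrite mulr1 -poweR_EFin; apply: gt0_ler_poweR; rewrite ?(ltW p0)//.
  - by rewrite in_itv/= lee_fin v0 leey.
  - by rewrite in_itv/= abse_ge0 leey.
  - exact: fA.
by rewrite mulr0 poweR_ge0.
Qed.

(** If the essential supremum were below [v], the interval [[0, tau]] would lie in a null set. *)
Lemma Lnorm_infty_ge (v : R) (tau : R) (h : R -> R) : 0 < tau ->
  (forall t, 0 <= t <= tau -> v <= `|h t|) ->
  (v%:E <= 'N[@lebesgue_measure R]_(+oo%E) [(fun t => (h t)%:E)])%E.
Proof.
move=> tau0 hv; rewrite unlock.
(* The norm of exponent [+oo] is defined by cases on whether the whole space has positive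
   measure. *)
have lebT : (0 < (@lebesgue_measure R) setT)%E.
  apply: (@lt_le_trans _ _ (leb `[0, tau]%classic)).
    by rewrite lebesgue_measure_itv/= lte_fin tau0 -EFinB subr0 lte_fin.
  by apply: le_measure; rewrite ?inE//; exact: subsetT.
rewrite lebT leNgt; apply/negP => lt.
have := ess_sup_ge leb (abse \o (fun t => (h t)%:E)).
move=> [N [mN N0 sN]].
pose I : set mR := `[0, tau]%classic.
have mI : measurable I by exact: measurable_itv.
have : (leb I <= leb N)%E.
  apply: le_measure; rewrite ?inE// => t; rewrite /I /= in_itv/= => /hv vt.
  apply: sN => /= le; have := le_lt_trans le lt.
  by rewrite lte_fin ltNge vt.
rewrite N0 /I lebesgue_measure_itv/= lte_fin tau0 -EFinB subr0 lee_fin.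
by rewrite leNgt tau0.
Qed.

Lemma cos_ge_cos1 (y : R) : `|y| <= 1 -> cos 1 <= cos y.
Proof.
move=> y1; rewrite -(cos_norm y); have := @pi_ge2 R => p2.
move: y1; rewrite le_eqVlt => /orP[/eqP->//|y1]; apply/ltW.
by rewrite ltr_cos// in_itv/= ?normr_ge0 ?ler01/=; lra.
Qed.

End NormBounds.

Section DyadicAnnulus.
Context {R : realType}.
Local Notation mR := (measurableTypeR R).
Variable k : nat.
Local Notation N := (2 ^+ k : R).
Local Notation ann := (@dyadic_annulus R k).

(** The intervals are disjoint since [2^k > 0], so the identity holds at every point, endpoints
    included. It brings the data into the reach of [weak_inversion], which speaks of intervals. *)
Lemma dyadic_annulus_indic (xi : R) : \1_ann xi =
  \1_`[N, 2 ^+ k.+1]%classic xi + \1_`[- 2 ^+ k.+1, - N]%classic xi :> R.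
Proof.
have N0 : 0 < N by rewrite exprn_gt0.
have memE (b : R -> bool) : (xi \in [set x | b x]) = b xi.
  by apply/idP/idP => [/set_mem|/mem_set].
rewrite !indicE !memE !in_itv/= -natrD; congr (_%:R).
have [x0|x0] := leP 0 xi.
  rewrite (ger0_norm x0); have -> : (xi <= - N) = false by lra.
  by rewrite andbF addn0.
rewrite (ltr0_norm x0) lerNr lerNl.
have -> : (N <= xi) = false by lra.
by rewrite add0n andbC.
Qed.

Lemma measurable_dyadic_annulus : measurable (ann : set mR).
Proof.
apply/(@measurable_indicP _ mR R).
rewrite (_ : \1_ann = (fun xi => \1_`[N, 2 ^+ k.+1]%classic xi +
    \1_`[- 2 ^+ k.+1, - N]%classic xi)).
  by apply: measurable_funD; exact: measurable_indic.
by apply/funext => xi; exact: dyadic_annulus_indic.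
Qed.

Lemma integral_dyadic_annulus : (\int[leb]_xi (\1_ann xi)%:E)%E = (2 * N)%:E.
Proof.
have N0 : 0 < N by rewrite exprn_gt0.
under eq_integral do rewrite dyadic_annulus_indic EFinD.
rewrite integralD//; do ?exact: integrable_indic_itv.
have itvE (u v : R) : u < v ->
    (\int[leb]_x (\1_`[u, v]%classic x)%:E = (v - u)%:E)%E.
  move=> uv; rewrite integral_indic// setIT.
  have := lebesgue_measure_itv `[u, v]; rewrite /= lte_fin uv => E.
  exact: E.
rewrite !itvE ?exprS; [|lra|lra].
by rewrite -EFinD; congr EFin; ring.
Qed.

Lemma lebesgue_dyadic_annulus : leb ann = (2 * N)%:E.
Proof.
rewrite -integral_dyadic_annulus integral_indic ?setIT//.
exact: measurable_dyadic_annulus.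
Qed.

End DyadicAnnulus.

Section DyadicData.
Context {R : realType}.
Local Notation mR := (measurableTypeR R).
Variables (s : R) (k : nat).
Local Notation N := (2 ^+ k : R).
Local Notation ann := (@dyadic_annulus R k).
Let a : R := 2 `^ (- (k%:R * (s + 1 / 2))).
Let c0 : R := (Num.sqrt (2 * pi))^-1.
Let T : distr R := distr_of_fun (f_dyadic s k).

Definition dyadic_fourier (xi : R) : R[i] :=
  (2 `^ (- (k%:R * (s + 1 / 2))) * \1_ann xi)%:C%C.

Let a0 : 0 < a. Proof. exact: powR_gt0. Qed.

Let c0E : c0%:C%C * c0%:C%C * (2 * pi)%:C%C = 1.
Proof.
rewrite -!rmorphM/= -invfM -expr2 sqr_sqrtr ?mulVf//.
- by rewrite mulf_neq0// gt_eqF// pi_gt0.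
- by rewrite mulr_ge0// pi_ge0.
Qed.

Lemma dyadic_fourier_integrable : cintegrable dyadic_fourier.
Proof.
split => /=; last exact: integrable0.
apply: integrable_scale.
apply: (integrable_indic_fin _ (lebesgue_dyadic_annulus k)).
exact: measurable_dyadic_annulus.
Qed.

Let gE xi : dyadic_fourier xi =
  a%:C%C * (\1_`[N, 2 ^+ k.+1]%classic xi)%:C%C +
  a%:C%C * (\1_`[- 2 ^+ k.+1, - N]%classic xi)%:C%C.
Proof.
by rewrite /dyadic_fourier dyadic_annulus_indic mulrDr rmorphD !rmorphM.
Qed.

(** Pairing [f_k] with the transform of [phi] gives two instances of [weak_inversion] with
    [h = phi], one for each interval of the annulus; the two factors [c0] cancel the [2 * pi]. *)
Lemma represents_dyadic_fourier :
  represents dyadic_fourier (distr_fourier T).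
Proof.
have ig := dyadic_fourier_integrable; have mg := cintegrable_cmeas ig.
have gb xi : normc (dyadic_fourier xi) <= a.
  rewrite normcR ger0_norm ?mulr_ge0 ?(ltW a0)// ?indicE//.
  by rewrite ler_piMr ?(ltW a0)// lern1 leq_b1.
split=> // phi sp; have ip := schwartz_integrable sp; split.
  by under eq_fun do rewrite mulrC; exact: cintegrableMb ip mg gb.
have iF := schwartz_fourier_ker_integrable sp.
pose m I x := cintegral (fun y => cexpi (x * y) * (\1_I y)%:C%C) : R[i].
pose F x := cintegral (fun y => cexpi (- (y * x)) * phi y).
rewrite /distr_fourier /T /distr_of_fun.
pose I1 : set R := `[N, 2 ^+ k.+1]%classic.
pose I2 : set R := `[- 2 ^+ k.+1, - N]%classic.
have i1 : cintegrable (fun y => (\1_I1 y)%:C%C) by exact: cintegrable_indic_itv.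
have i2 : cintegrable (fun y => (\1_I2 y)%:C%C) by exact: cintegrable_indic_itv.
have iFm I : cintegrable (fun y => (\1_I y)%:C%C) -> cintegrable (fun x => F x * m I x).
  move=> iI; apply: (cintegrableMb iF).
    exact: (cmeasurable_inv_fourier_ker (cintegrable_cmeas iI)).
  by move=> x; exact: normc_inv_fourier_ker_le.
have iphi I : cintegrable (fun y => (\1_I y)%:C%C) ->
    cintegrable (fun y => phi y * (\1_I y)%:C%C).
  move=> iI; apply: (cintegrableMb (M := 1) ip (cintegrable_cmeas iI)) => y.
  by rewrite normcR indicE ger0_norm// lern1 leq_b1.
rewrite (eq_cintegral (g := fun x =>
    (c0%:C%C * c0%:C%C * a%:C%C) * (F x * m I1 x) +
    (c0%:C%C * c0%:C%C * a%:C%C) * (F x * m I2 x))); last first.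
  move=> x; rewrite /f_dyadic /fourier /inv_fourier -/(F x) -/c0.
  rewrite (_ : cintegral _ = a%:C%C * m I1 x + a%:C%C * m I2 x); first by ring.
  rewrite (eq_cintegral (g := fun y =>
    a%:C%C * (cexpi (x * y) * (\1_I1 y)%:C%C) +
    a%:C%C * (cexpi (x * y) * (\1_I2 y)%:C%C))); last first.
    by move=> y; rewrite -/(dyadic_fourier y) gE; ring.
  by rewrite cintegralD ?cintegralZl//; do ?apply: cintegrableZl;
    exact: cintegrable_inv_fourier_ker.
rewrite cintegralD ?cintegralZl//; do ?[by exact: iFm | by apply: cintegrableZl; exact: iFm].
have N0 : 0 < N by rewrite exprn_gt0.
rewrite weak_inversion//; last by rewrite exprS; lra.
rewrite weak_inversion//; last by rewrite exprS; lra.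
transitivity (a%:C%C * cintegral (fun y => phi y * (\1_I1 y)%:C%C) +
    a%:C%C * cintegral (fun y => phi y * (\1_I2 y)%:C%C)).
  have E (z : R[i]) : c0%:C%C * c0%:C%C * a%:C%C * ((2 * pi)%:C%C * z) = a%:C%C * z.
    by rewrite -[RHS]mul1r -c0E; ring.
  by rewrite !E.
rewrite -!cintegralZl; do ?exact: iphi.
rewrite -cintegralD; do ?[by apply: cintegrableZl; exact: iphi].
by apply: eq_cintegral => y; rewrite gE; ring.
Qed.

Lemma fourier_fun_dyadic_integrable : cintegrable (fourier_fun T).
Proof.
have rg := represents_dyadic_fourier; have [mf _] := fourier_fun_represents rg.
exact: cintegrable_ae_eq mf dyadic_fourier_integrable (fourier_fun_ae rg).
Qed.

Lemma tempered_dyadic : tempered T.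
Proof.
have ig := dyadic_fourier_integrable.
apply: (bounded_tempered (B := normc c0%:C%C *
    (2 * \int[leb]_y normc (dyadic_fourier y)))).
- apply: cmeasurableM; first exact: cmeasurable_cst.
  exact: (cmeasurable_inv_fourier_ker (cintegrable_cmeas ig)).
- move=> x; rewrite /f_dyadic /inv_fourier Normc.normcM ler_wpM2l ?normc_ge0//.
  exact: (normc_inv_fourier_ker_le x ig).
Qed.

End DyadicData.

(** * Upper and lower bounds for the dyadic data *)

Section DyadicEstimates.
Context {R : realType}.
Local Notation mR := (measurableTypeR R).
Variables (s : R) (k : nat).
Local Notation N := (2 ^+ k : R).
Local Notation ann := (@dyadic_annulus R k).
Let a : R := 2 `^ (- (k%:R * (s + 1 / 2))).
Let c0 : R := (Num.sqrt (2 * pi))^-1.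
Let T : distr R := distr_of_fun (f_dyadic s k).

Let a0 : 0 < a. Proof. exact: powR_gt0. Qed.
Let N1 : 1 <= N. Proof. by rewrite exprn_ege1// ler1n. Qed.
Let N0 : 0 < N. Proof. by rewrite exprn_gt0. Qed.

Let c0_gt0 : 0 < c0.
Proof. by rewrite invr_gt0 sqrtr_gt0 mulr_gt0// pi_gt0. Qed.

Let Npow (r : R) : N `^ r = 2 `^ (k%:R * r).
Proof. by rewrite -powR_mulrn// -powRrM. Qed.

Let annP (xi : R) : (xi \in ann) -> N <= `|xi| <= 2 * N.
Proof. by move=> /set_mem; rewrite /dyadic_annulus /= exprS. Qed.

(** On the annulus the bracket lies between [N] and [3 N], as [1 + 4 N^2 <= 9 N^2]. Writing it as
    [N] times a ratio in [[1, 3]] and using the exponent [|s|] on the ratio covers both signs of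
    [s]. *)
Lemma japanese_bracket_dyadic_le (xi : R) : xi \in ann ->
  japanese_bracket xi `^ s <= 3 `^ `|s| * N `^ s.
Proof.
move=> /annP/andP[h1 h2]; set J := japanese_bracket xi.
have J1 : N <= J.
  rewrite -(ger0_norm (ltW N0)) -sqrtr_sqr ler_wsqrtr//.
  rewrite -(real_normK (num_real xi)) ler_wpDl//.
  by rewrite ler_pXn2r// nnegrE ltW.
have J3 : J <= N * 3.
  rewrite -[leRHS]ger0_norm ?mulr_ge0 ?(ltW N0)// -sqrtr_sqr ler_wsqrtr//.
  rewrite -(real_normK (num_real xi)); move: h2 N1 (normr_ge0 xi).
  by move: `|xi| N => y M; rewrite !expr2; nra.
have -> : J = N * (J / N) by rewrite mulrCA divff ?mulr1// gt_eqF.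
have r1 : 1 <= J / N by rewrite ler_pdivlMr// mul1r.
have r3 : J / N <= 3 by rewrite ler_pdivrMr// mulrC.
rewrite powRM ?(ltW N0) ?(le_trans ler01 r1)// mulrC ler_wpM2r ?powR_ge0//.
apply: (@le_trans _ _ ((J / N) `^ `|s|)); first by apply: ler_powR => //; exact: ler_norm.
by apply: ge0_ler_powR => //; rewrite nnegrE// (le_trans ler01 r1).
Qed.

Lemma sobolev_norm_dyadic_le :
  (sobolev_norm s T <= ((2 * (3 `^ `|s|) ^+ 2) `^ 2^-1)%:E)%E.
Proof.
have rg := represents_dyadic_fourier s k.
have [mff _] := fourier_fun_represents rg; have fae := fourier_fun_ae rg.
have mg := cintegrable_cmeas (dyadic_fourier_integrable s k).
rewrite /sobolev_norm asboolT; last by exists (dyadic_fourier s k).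
rewrite unlock -poweR_EFin; apply: gt0_ler_poweR.
- by rewrite invr_ge0.
- by rewrite in_itv/= leey andbT; apply: integral_ge0 => x _; rewrite lee_fin powR_ge0.
- by rewrite in_itv/= leey andbT lee_fin mulr_ge0// exprn_ge0// powR_ge0.
have mj (f : R -> R[i]) : cmeas f -> measurable_fun setT
    ((fun xi => (`|(japanese_bracket xi `^ s * normc (f xi))%:E| `^ 2)%E) : mR -> \bar R).
  move=> mf; apply: (measurableT_comp (measurable_poweR _)).
  apply: measurableT_comp => //; apply/measurable_EFinP.
  apply: measurable_funM; last exact: measurable_normc.
  apply: (measurableT_comp (measurable_powR _)).
  rewrite (_ : @japanese_bracket R = (fun xi => (1 + xi ^+ 2) `^ 2^-1)).
    apply: (measurableT_comp (measurable_powR _)).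
    by apply: measurable_funD; [exact: measurable_cst|exact: measurable_funX].
  by apply/funext => xi; rewrite powR12_sqrt// addr_ge0 ?sqr_ge0.
pose B := 3 `^ `|s|; pose v := N `^ s * a.
(* The normalisation of [f_k]: [v] is [2^(- k / 2)], so [v^2] compensates the measure [2 N] of the
   annulus and the final bound does not depend on [k]. *)
have vN : v ^+ 2 * N = 1.
  rewrite /v Npow /a -powRD ?pnatr_eq0 ?implybT// -powR_mulrn ?powR_ge0//.
  rewrite -powRrM -[X in _ * X]powRr1 ?(ltW N0)// Npow -powRD ?pnatr_eq0 ?implybT//.
  by rewrite (_ : _ + _ = 0) ?powRr0//; field.
rewrite -/B; have -> : (2 * B ^+ 2)%:E = (\int[leb]_xi (((B * v) ^+ 2) * \1_ann xi)%:E)%E.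
  under eq_integral do rewrite EFinM.
  rewrite integralZl//; last first.
    apply: (integrable_indic_fin _ (lebesgue_dyadic_annulus k)).
    exact: measurable_dyadic_annulus.
  rewrite integral_dyadic_annulus -EFinM; congr EFin.
  transitivity (2 * B ^+ 2 * (v ^+ 2 * N)); first by rewrite vN mulr1.
  by ring.
apply: (@le_trans _ _ (\int[leb]_xi
   (`|(japanese_bracket xi `^ s * normc (dyadic_fourier s k xi))%:E| `^ 2))%E).
  rewrite le_eqVlt; apply/orP; left; apply/eqP; apply: ae_eq_integral => //.
  - exact: mj.
  - exact: mj.
  - by apply: (@filterS _ _ (ae_filter_ringOfSetsType leb)) fae => xi /= ->.
apply: ge0_le_integralT => xi; first exact: poweR_ge0.
rewrite normcR ger0_norm ?mulr_ge0 ?(ltW a0)// ?indicE//.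
rewrite abse_EFin poweR_EFin lee_fin powR_mulrn// ger0_norm ?mulr_ge0 ?powR_ge0 ?(ltW a0)//.
case: (boolP (xi \in ann)) => [xa|_]; last by rewrite !mulr0 expr0n.
rewrite !mulr1 ler_pXn2r ?nnegrE ?mulr_ge0 ?powR_ge0 ?(ltW a0)//.
by rewrite /v mulrA ler_wpM2r ?powR_ge0// japanese_bracket_dyadic_le.
Qed.

(** Each term is at most [1 / 2]: [|xi| <= 2 N] for the first, and
    [|xi^3| + |1 / xi| <= 8 N^3 + 1 <= 16 N^3] for the second. The sign in the dispersion disappears
    in [|1 / xi| <= 1]. *)
Lemma phase_le (neg : bool) (xi x t : R) : xi \in ann ->
  `|x| <= (4 * N)^-1 -> 0 <= t <= (32 * N ^+ 3)^-1 ->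
  `|x * xi + t * dispersion neg xi| <= 1.
Proof.
move=> /annP/andP[h1 h2] hx /andP[t0 ht].
have x1 : `|x| * `|xi| <= 1 / 2.
  apply: (@le_trans _ _ ((4 * N)^-1 * (2 * N))); first by rewrite ler_pM.
  by rewrite le_eqVlt; apply/orP; left; apply/eqP; field; rewrite gt_eqF.
have d1 : `|dispersion neg xi| <= 16 * N ^+ 3.
  apply: le_trans (ler_normD _ _) _.
  rewrite normrX normrM normrX normrN1 expr1n mul1r normfV.
  have i1 : `|xi|^-1 <= 1 by rewrite invf_le1 ?(lt_le_trans N0)// (le_trans N1).
  have i3 : `|xi| ^+ 3 <= (2 * N) ^+ 3.
    by rewrite ler_pXn2r// nnegrE ?mulr_ge0 ?(ltW N0).
  have n3 : 1 <= N ^+ 3 by rewrite exprn_ege1.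
  by rewrite exprMn in i3; lra.
have t1 : t * `|dispersion neg xi| <= 1 / 2.
  apply: (@le_trans _ _ ((32 * N ^+ 3)^-1 * (16 * N ^+ 3))); first by rewrite ler_pM.
  by rewrite le_eqVlt; apply/orP; left; apply/eqP; field; rewrite gt_eqF.
apply: le_trans (ler_normD _ _) _; rewrite !normrM (ger0_norm t0); lra.
Qed.

(* For [t] and [x] this small the phase stays in [-1, 1], so there is no
   cancellation in the oscillatory integral. *)
Lemma ostrovsky_dyadic_ge (neg : bool) (x t : R) :
  `|x| <= (4 * N)^-1 -> 0 <= t <= (32 * N ^+ 3)^-1 ->
  c0 * (cos 1 * a * (2 * N)) <= normc (ostrovsky neg t T x).
Proof.
move=> hx ht.
have rg := represents_dyadic_fourier s k.
have ig := dyadic_fourier_integrable s k.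
rewrite (ostrovskyE neg t x ig rg) /inv_fourier Normc.normcM normcR -/c0.
rewrite (ger0_norm (ltW c0_gt0)) ler_wpM2l ?(ltW c0_gt0)//.
apply: le_trans (le_trans (ler_norm _) (Re_le_normc _)).
have ie := cintegrable_inv_fourier_ker x (cintegrable_evolution neg t ig).
have iann := integrable_indic_fin (measurable_dyadic_annulus k) (lebesgue_dyadic_annulus k).
have -> : cos 1 * a * (2 * N) = \int[leb]_xi ((cos 1 * a) * \1_ann xi).
  by rewrite RintegralZl//; congr (_ * _); rewrite /Rintegral integral_dyadic_annulus.
apply: le_Rintegral => //; first exact: integrable_scale.
  by case: ie.
move=> xi _; rewrite /dyadic_fourier mulrA -cexpiD cReM/= mulr0 subr0 -/a.
rewrite indicE; case: (boolP (xi \in ann)) => [xa|_]; last by rewrite !mulr0.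
rewrite !mulr1 ler_wpM2r ?(ltW a0)//; apply: cos_ge_cos1.
exact: phase_le.
Qed.

(** The part of the lower bound independent of [k]: the Fourier constant, the least cosine of the
    phase, the 2 in the measure [2 N] of the annulus, and the [1/2] in the length [1 / (2 N)] of the
    [x]-interval, to the power [1/4] from the [L^4] norm. *)
Let kappa : R := c0 * cos 1 * 2 * 2^-1 `^ 4^-1.

(** The exponents of 2 are [- k (s + 1/2)] from the data, [k] from the annulus and [- k / 4] from
    the [x]-interval; they add up to [k (1/4 - s)], the source of the threshold. *)
Let amplitude : c0 * (cos 1 * a * (2 * N)) * (2 * N)^-1 `^ 4^-1 =
  kappa * 2 `^ (k%:R * (1 / 4 - s)).
Proof.
rewrite invfM powRM ?invr_ge0 ?(ltW N0)//.
have -> : N^-1 `^ 4^-1 = 2 `^ (k%:R * (- 4^-1)).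
  by rewrite -powR_inv1 ?(ltW N0)// -powRrM mulN1r Npow.
have -> : 2 `^ (k%:R * (1 / 4 - s)) = a * N * 2 `^ (k%:R * (- 4^-1)).
  rewrite -[X in _ * X * _]powRr1 ?(ltW N0)// Npow /a.
  rewrite -!powRD ?pnatr_eq0 ?implybT//; congr (2 `^ _); by field.
by rewrite /kappa; ring.
Qed.

Let V0 : 0 <= c0 * (cos 1 * a * (2 * N)).
Proof. by rewrite !mulr_ge0 ?(ltW c0_gt0) ?(ltW a0) ?(ltW N0) ?(ltW (@cos1_gt0 R)). Qed.

Let lebI : leb (`[- (4 * N)^-1, (4 * N)^-1]%classic : set mR) = ((2 * N)^-1)%:E.
Proof.
rewrite lebesgue_measure_itv/= lte_fin gtrN ?invr_gt0 ?mulr_gt0// -EFinB.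
by congr EFin; field; rewrite gt_eqF.
Qed.

Let tau0 : 0 < (32 * N ^+ 3)^-1.
Proof. by rewrite invr_gt0 mulr_gt0// exprn_gt0. Qed.

Lemma maximal_dyadic_ge (neg : bool) :
  ((kappa * 2 `^ (k%:R * (1 / 4 - s)))%:E <=
    'N[@lebesgue_measure R]_(4%:E) [maximal_fun neg T])%E.
Proof.
rewrite -amplitude; apply: (Lnorm_ge _ V0 _ _ lebI) => //.
move=> x /=; rewrite in_itv/= -ler_norml => hx.
apply: le_trans (lee_abs _).
(* The supremum runs over positive times, so the right end of the admissible interval is taken as
   witness. *)
apply: (@le_trans _ _ (normc (ostrovsky neg (32 * N ^+ 3)^-1 T x))%:E).
  by rewrite lee_fin ostrovsky_dyadic_ge// lexx ltW.
by apply: ereal_sup_ubound; exists (32 * N ^+ 3)^-1.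
Qed.

Lemma mixed_norm_dyadic_ge (neg : bool) :
  ((kappa * 2 `^ (k%:R * (1 / 4 - s)))%:E <=
    mixed_norm 4%:E +oo (fun p => ostrovsky neg p.2 T p.1))%E.
Proof.
rewrite -amplitude; apply: (Lnorm_ge _ V0 _ _ lebI) => //.
move=> x /=; rewrite in_itv/= -ler_norml => hx.
apply: le_trans (lee_abs _).
apply: (Lnorm_infty_ge tau0) => t ht; rewrite ger0_norm ?normc_ge0//.
exact: ostrovsky_dyadic_ge.
Qed.

End DyadicEstimates.

(** By [exp z >= 1 + z], the power [2^(k e)] grows at least linearly in [k]. *)
Lemma powR2_unbounded (R : realType) (c e A : R) : 0 < c -> 0 < e ->
  \forall k \near \oo, A <= c * 2 `^ (k%:R * e).
Proof.
move=> c0 e0; have l0 : 0 < ln (2 : R) by rewrite ln_gt0// ltr1n.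
near=> k.
apply: (@le_trans _ _ (c * (k%:R * e * ln 2))).
  rewrite -ler_pdivrMl// -ler_pdivrMr// -ler_pdivrMr//.
  by near: k; exact: nbhs_infty_ger.
rewrite ler_wpM2l ?(ltW c0)// /powR pnatr_eq0/=.
by apply: le_trans (expR_ge1Dx _); rewrite lerDr.
Unshelve. all: by end_near. Qed.

(** The Sobolev norm is bounded only from above, so the denominator may a priori be 0; the extended
    inverse of 0 is [+oo], and the quotient is then [+oo]. *)
Lemma lee_div_bound (R : realType) (v C : R) (x y : \bar R) : 0 < v -> 0 < C ->
  (v%:E <= x)%E -> (0 <= y)%E -> (y <= C%:E)%E -> ((v / C)%:E <= x / y)%E.
Proof.
move=> v0 C0 vx; case: y => [y||]//; rewrite !lee_fin => y0 yC.
have [->|yn0] := eqVneq y 0.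
  rewrite /inve eqxx; have -> : (x * +oo = +oo)%E; last by rewrite leey.
  by rewrite gt0_muley// (lt_le_trans _ vx)// lte_fin.
have y0' : 0 < y by rewrite lt_neqAle eq_sym yn0.
rewrite /inve (negbTE yn0); apply: (@le_trans _ _ (v%:E * (y^-1)%:E)%E).
  by rewrite -EFinM lee_fin ler_wpM2l ?(ltW v0)// lef_pV2 ?posrE.
by apply: lee_wpmul2r => //; rewrite lee_fin invr_ge0.
Qed.

Theorem theorem1p2 (R : realType) (neg : bool) (s : R) (hs : s < 1 / 4) :
  (('N[@lebesgue_measure R]_(4%:E)
      [maximal_fun neg (distr_of_fun (f_dyadic s k))]
    / sobolev_norm s (distr_of_fun (f_dyadic s k)))%E @[k --> \oo] --> +oo%E)
  /\ ~ (exists A : R, ostrovsky_maximal_inequality neg s A).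
Proof.
pose kappa : R := (Num.sqrt (2 * pi))^-1 * cos 1 * 2 * 2^-1 `^ 4^-1.
have kappa0 : 0 < kappa.
  rewrite !mulr_gt0 ?cos1_gt0 ?powR_gt0 ?invr_gt0//.
  by rewrite sqrtr_gt0 mulr_gt0// pi_gt0.
pose C : R := (2 * (3 `^ `|s|) ^+ 2) `^ 2^-1.
have C0 : 0 < C by rewrite powR_gt0// mulr_gt0// exprn_gt0// powR_gt0.
have e0 : 0 < 1 / 4 - s by rewrite subr_gt0.
have sob0 k : (0 <= sobolev_norm s (distr_of_fun (f_dyadic s k)))%E.
  by rewrite /sobolev_norm; case: ifP => // _; exact: Lnorm_ge0.
split.
- apply/cvgeyPge => A.
  have := powR2_unbounded (A * C) kappa0 e0; apply: filterS => k hk.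
  apply: (@le_trans _ _ ((kappa * 2 `^ (k%:R * (1 / 4 - s))) / C)%:E).
    by rewrite lee_fin ler_pdivlMr.
  apply: lee_div_bound => //.
  + by rewrite mulr_gt0// powR_gt0.
  + exact: maximal_dyadic_ge.
  + exact: sobolev_norm_dyadic_le.
- move=> [A hA].
  (* The candidate constant may be negative, hence [|A|]; the added 1 makes the contradiction
     strict. A single large [k] suffices. *)
  have [k _ /(_ k (leqnn k))/= hk] := powR2_unbounded (`|A| * C + 1) kappa0 e0.
  pose T := distr_of_fun (f_dyadic s k).
  have sobC : (sobolev_norm s T <= C%:E)%E := sobolev_norm_dyadic_le s k.
  have sT : sobolev s T.
    by split; [exact: tempered_dyadic|rewrite (le_lt_trans sobC)// ltry].
  have := hA T sT _ (ostrovsky_versionP neg (fourier_fun_dyadic_integrable s k)).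
  apply/negP; rewrite -ltNge.
  apply: (@le_lt_trans _ _ (`|A| * C)%:E).
    apply: (@le_trans _ _ (`|A|%:E * sobolev_norm s T)%E).
      by apply: lee_wpmul2r; [exact: sob0|rewrite lee_fin ler_norm].
    by rewrite EFinM; apply: lee_wpmul2l => //; rewrite lee_fin.
  apply: lt_le_trans (mixed_norm_dyadic_ge s k neg).
  by rewrite lte_fin; apply: lt_le_trans hk; rewrite ltrDl.
Qed.
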